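(* We have $$\frac{\varphi^2(e^{-7\pi\sqrt{3}})}{\varphi^2(e^{-\pi\sqrt{3}})} = \frac{1}{42\sqrt{3}}\left(\big(\sqrt{21}+3\big)(28)^{1/3} + 8\sqrt{3}\,(28)^{1/6}+4\sqrt{21} + 6\right).$$
   Context: For $|q|<1$, Ramanujan's theta function is $\varphi(q) := \sum_{n=-\infty}^{\infty} q^{n^2}$, and $\varphi^2(q)$ means $(\varphi(q))^2$. *)

(* Defs.v *)
From Stdlib Require Import Reals ZArith Lra Lia.
From Coquelicot Require Import Coquelicot.

Open Scope R_scope.

(** A sum over all of [Z], as the sum of its two one-sided series.  [Series] is
    total, so the value is meaningful only when both of these converge. *)
Definition bilateral_series (f : Z -> R) : R :=
  Series (fun n : nat => f (Z.of_nat n))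
  + Series (fun n : nat => f (- Z.of_nat (S n))%Z).

Definition ramanujan_phi (q : R) : R :=
  bilateral_series (fun n : Z => powerRZ q (n * n)%Z).

Lemma ramanujan_phi_converges (q : R) : Rabs q < 1 ->
  ex_series (fun n : nat => powerRZ q (Z.of_nat n * Z.of_nat n)%Z) /\
  ex_series (fun n : nat =>
    powerRZ q ((- Z.of_nat (S n)) * (- Z.of_nat (S n)))%Z).
Proof.
intros Hq.
assert (H : ex_series
  (fun n : nat => powerRZ q (Z.of_nat n * Z.of_nat n)%Z)).
{ apply (@ex_series_le R_AbsRing R_CompleteNormedModule _ (pow (Rabs q))).
  - intros n.
    rewrite <- Nat2Z.inj_mul, <- pow_powerRZ.
    change (Rabs (q ^ (n * n)) <= Rabs q ^ n).
    rewrite <- RPow_abs.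
    assert (Hn : (n <= n * n)%nat) by (destruct n; nia).
    replace (n * n)%nat with (n + (n * n - n))%nat by lia.
    rewrite pow_add.
    assert (H1 : 0 <= Rabs q ^ n) by (apply pow_le, Rabs_pos).
    assert (H2 : Rabs q ^ (n * n - n) <= 1).
    { rewrite <- (pow1 (n * n - n)). apply pow_incr.
      split; [apply Rabs_pos | lra]. }
    nra.
  - apply ex_series_geom. rewrite Rabs_Rabsolu. exact Hq. }
split; [exact H |].
apply ex_series_incr_1 in H.
apply (ex_series_ext (fun n : nat => powerRZ q (Z.of_nat (S n) * Z.of_nat (S n))%Z)); [| exact H].
reflexivity.
Qed.

(* Main.v *)
(** Let [r = phi^2(q^7) / phi^2(q)] at [q = exp(-pi sqrt 3)], and let [alpha], [beta] be the
    squared elliptic moduli [theta2^4 / theta3^4] at [q] and at [q^7].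
    Poisson summation (obtained here as a limit of return probabilities of the random walk on
    a cycle, following Polya) exchanges [theta2] and [theta4] under [t -> 1/t]; applied at
    [t = sqrt 3] together with the cubic identity
    [theta3(q) theta3(q^3) = theta2(q) theta2(q^3) + theta4(q) theta4(q^3)]
    it gives [16 alpha (1 - alpha) = 1].
    The degree 7 modular equation [(alpha beta)^(1/8) + ((1-alpha)(1-beta))^(1/8) = 1] is a
    rearrangement of double series indexed by the ring of integers of Q(sqrt(-7)), in which 2 splits.
    With [u = (alpha beta)^(1/8)] it becomes an octic equation for [u], solved explicitly.
    Finally [q dalpha/dq = alpha (1 - alpha) theta3^4]; differentiating the modular equation
    with it expresses [r^2] rationally in [u] and [alpha]. *)

Require Import Defs.
From Stdlib Require Import Reals ZArith Lra Lia List FinFun Classical.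
From Coquelicot Require Import Coquelicot.

Open Scope R_scope.

(** * Unordered sums of nonnegative families *)

(** Every series that occurs has nonnegative terms. A sum is therefore a supremum of finite sums
    over duplicate-free lists, any bijection of index types may be applied to it, and each double
    series identity reduces to comparing quadratic forms. This is also why theta4 is never an
    alternating series: it is a combination of two values of theta3. The modulus enters through y =
    theta4 / theta3 = (1 - alpha)^(1/4), because doubling t is an arithmetic-geometric mean step for
    theta3^2 and theta4^2. Duplication alone then yields the differential equation: the quotient of
    its two sides does not change under doubling, so it equals its limit at q = 0, and neither the
    heat equation nor Eisenstein series are needed. The octic comes from eliminating beta between
    u^8 = alpha beta and (1 - u)^8 = (1 - alpha)(1 - beta). What remains is to select roots:
    monotonicity of y decides between alpha and 1 - alpha, a crude bound on beta isolates u, and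
    positivity decides the sign of r. *)

Definition lsum {T : Type} (f : T -> R) (l : list T) : R :=
  fold_right (fun x acc => f x + acc) 0 l.

Definition has_sum {T : Type} (f : T -> R) (s : R) : Prop :=
  (forall x, 0 <= f x) /\
  (forall l, NoDup l -> lsum f l <= s) /\
  (forall eps, 0 < eps -> exists l, NoDup l /\ s - eps < lsum f l).

Lemma lsum_app {T} (f : T -> R) l l' : lsum f (l ++ l') = lsum f l + lsum f l'.
Proof. induction l as [|a l IH]; simpl; [|rewrite IH]; ring. Qed.

Lemma lsum_map {T U} (g : T -> U) (f : U -> R) l :
  lsum f (map g l) = lsum (fun x => f (g x)) l.
Proof. induction l as [|a l IH]; simpl; [|rewrite IH]; reflexivity. Qed.

Lemma lsum_ge0 {T} (f : T -> R) l : (forall x, 0 <= f x) -> 0 <= lsum f l.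
Proof.
intros H; induction l as [|a l IH]; simpl; [lra|].
specialize (H a); lra.
Qed.

Lemma lsum_le {T} (f g : T -> R) l :
  (forall x, f x <= g x) -> lsum f l <= lsum g l.
Proof.
intros H; induction l as [|a l IH]; simpl; [lra|].
specialize (H a); lra.
Qed.

Lemma lsum_plus {T} (f g : T -> R) l :
  lsum (fun x => f x + g x) l = lsum f l + lsum g l.
Proof. induction l as [|a l IH]; simpl; [|rewrite IH]; ring. Qed.

Lemma lsum_scal {T} c (f : T -> R) l :
  lsum (fun x => c * f x) l = c * lsum f l.
Proof. induction l as [|a l IH]; simpl; [|rewrite IH]; ring. Qed.

Lemma lsum_ext {T} (f g : T -> R) l :
  (forall x, f x = g x) -> lsum f l = lsum g l.
Proof. intros H; induction l as [|a l IH]; simpl; [|rewrite IH, H]; reflexivity. Qed.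

Lemma lsum_support {T} (f : T -> R) l l' :
  (forall x, 0 <= f x) -> NoDup l -> (forall x, In x l -> f x <> 0 -> In x l') ->
  lsum f l <= lsum f l'.
Proof.
intros Hf; revert l'; induction l as [|a l IH]; intros l' Hl Hi.
- apply lsum_ge0, Hf.
- inversion Hl; subst. simpl. destruct (Req_dec (f a) 0) as [E|E].
  { rewrite E, Rplus_0_l. apply IH; auto. intros x Hx; apply Hi; right; exact Hx. }
  destruct (in_split a l' (Hi a (or_introl eq_refl) E)) as [l1 [l2 ->]].
  assert (Hi' : forall x, In x l -> f x <> 0 -> In x (l1 ++ l2)).
  { intros x Hx Hn. specialize (Hi x (or_intror Hx) Hn).
    apply in_app_or in Hi; apply in_or_app.
    destruct Hi as [Hi|[Hi|Hi]]; auto. subst; contradiction. }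
  specialize (IH (l1 ++ l2) ltac:(assumption) Hi'). rewrite lsum_app in *; simpl. lra.
Qed.

Lemma lsum_incl {T} (f : T -> R) l l' :
  (forall x, 0 <= f x) -> NoDup l -> incl l l' -> lsum f l <= lsum f l'.
Proof. intros Hf Hl Hi. apply lsum_support; auto. Qed.

(** Equality on [T] is not assumed decidable, so duplicates are removed by excluded middle. *)
Lemma nodup_exists {T} (l : list T) :
  exists l', NoDup l' /\ incl l l' /\ incl l' l.
Proof.
induction l as [|a l [l' [H1 [H2 H3]]]].
- exists nil; split; [constructor|]; split; apply incl_refl.
- destruct (classic (In a l')) as [Ha|Ha].
  + exists l'; split; [exact H1|]; split.
    * apply incl_cons; assumption.
    * apply incl_tl, H3.
  + exists (a :: l'); split; [constructor; assumption|]; split.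
    * apply incl_cons; [left; reflexivity|]. apply incl_tl, H2.
    * apply incl_cons; [left; reflexivity|]. apply incl_tl, H3.
Qed.

Lemma has_sum_approx {T} (f : T -> R) s l eps : has_sum f s -> 0 < eps ->
  exists l', NoDup l' /\ incl l l' /\ s - eps < lsum f l'.
Proof.
intros [H0 [_ H]] He. destruct (H eps He) as [l0 [Hl0 Hs]].
destruct (nodup_exists (l ++ l0)) as [l' [H1 [H2 _]]].
exists l'; split; [exact H1|]; split.
- intros x Hx; apply H2, in_or_app; auto.
- apply Rlt_le_trans with (1 := Hs), lsum_incl; auto.
  intros x Hx; apply H2, in_or_app; auto.
Qed.

Lemma has_sum_le {T} (f g : T -> R) s s' :
  has_sum f s -> has_sum g s' -> (forall x, f x <= g x) -> s <= s'.
Proof.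
intros [_ [_ H]] [_ [H' _]] Hle. apply Rnot_lt_le; intros Hlt.
destruct (H (s - s') ltac:(lra)) as [l [Hl Hs]].
specialize (H' l Hl). pose proof (lsum_le f g l Hle). lra.
Qed.

Lemma has_sum_unique {T} (f : T -> R) s s' : has_sum f s -> has_sum f s' -> s = s'.
Proof.
intros H H'; apply Rle_antisym.
- apply (has_sum_le f f s s'); auto; intros; lra.
- apply (has_sum_le f f s' s); auto; intros; lra.
Qed.

Lemma has_sum_ext {T} (f g : T -> R) s :
  (forall x, f x = g x) -> has_sum f s -> has_sum g s.
Proof.
intros E [H0 [H1 H2]]; split; [intros x; rewrite <- E; auto|]; split.
- intros l Hl. rewrite <- (lsum_ext f g l E). auto.
- intros eps He. destruct (H2 eps He) as [l Hl]. exists l.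
  rewrite <- (lsum_ext f g l E). exact Hl.
Qed.

Lemma has_sum_ge0 {T} (f : T -> R) s : has_sum f s -> 0 <= s.
Proof. intros [_ [H _]]. apply (H nil). constructor. Qed.

Lemma has_sum_term {T} (f : T -> R) s x : has_sum f s -> f x <= s.
Proof.
intros [_ [H _]]. specialize (H (x :: nil)). simpl in H.
rewrite Rplus_0_r in H. apply H. constructor; [intros []|constructor].
Qed.

Lemma has_sum_dom {T} (f : T -> R) (M : R) : (forall x, 0 <= f x) ->
  (forall l, NoDup l -> lsum f l <= M) -> exists s, has_sum f s.
Proof.
intros H0 HM.
destruct (completeness (fun y => exists l, NoDup l /\ y = lsum f l)) as [s [Hu Hl]].
- exists M; intros y [l [Hl ->]]; auto.
- exists 0, nil; split; [constructor|reflexivity].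
- exists s; split; [exact H0|]; split.
  + intros l Hn. apply Hu. exists l; auto.
  + intros eps He. apply NNPP; intros Hno.
    assert (s <= s - eps); [|lra]. apply Hl. intros y [l [Hn ->]].
    apply Rnot_lt_le; intros Hlt. apply Hno. exists l; auto.
Qed.

Lemma has_sum_inj {T U} (i : U -> T) (f : T -> R) s :
  (forall x y, i x = i y -> x = y) -> has_sum f s ->
  exists s', has_sum (fun x => f (i x)) s'.
Proof.
intros Hi [H0 [H1 _]]. apply has_sum_dom with s; [intros; apply H0|].
intros l Hl. rewrite <- lsum_map. apply H1.
apply Injective_map_NoDup; auto.
Qed.

Lemma has_sum_bij {T U} (g : U -> T) (h : T -> U) (f : T -> R) s :
  (forall x, g (h x) = x) -> (forall y, h (g y) = y) ->
  has_sum f s -> has_sum (fun x => f (g x)) s.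
Proof.
intros Hgh Hhg [H0 [H1 H2]].
assert (Hi : Injective g)
  by (intros x y E; rewrite <- (Hhg x), <- (Hhg y), E; reflexivity).
assert (Hj : Injective h)
  by (intros x y E; rewrite <- (Hgh x), <- (Hgh y), E; reflexivity).
split; [intros; apply H0|]; split.
- intros l Hl. rewrite <- lsum_map. apply H1, Injective_map_NoDup; auto.
- intros eps He. destruct (H2 eps He) as [l [Hl Hs]].
  exists (map h l); split; [apply Injective_map_NoDup; auto|].
  rewrite lsum_map. rewrite (lsum_ext _ f); auto. intros x; rewrite Hgh; auto.
Qed.

Lemma has_sum_scal {T} c (f : T -> R) s : 0 <= c ->
  has_sum f s -> has_sum (fun x => c * f x) (c * s).
Proof.
intros Hc [H0 [H1 H2]]; split; [|split].
- intros x; apply Rmult_le_pos; auto.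
- intros l Hl. rewrite lsum_scal. apply Rmult_le_compat_l; auto.
- intros eps He. destruct (H2 (eps / (c + 1))) as [l [Hl Hs]].
  { apply Rdiv_lt_0_compat; lra. }
  exists l; split; [exact Hl|]. rewrite lsum_scal.
  assert (c * (eps / (c + 1)) < eps).
  { apply Rmult_lt_reg_r with (c + 1); [lra|]. field_simplify; [|lra]. nra. }
  nra.
Qed.

Lemma has_sum_plus {T} (f g : T -> R) a b :
  has_sum f a -> has_sum g b -> has_sum (fun x => f x + g x) (a + b).
Proof.
intros Hf Hg; split; [|split].
- intros x. destruct Hf as [Hf _], Hg as [Hg _]. specialize (Hf x); specialize (Hg x); lra.
- intros l Hl. rewrite lsum_plus. destruct Hf as [_ [Hf _]], Hg as [_ [Hg _]].
  specialize (Hf l Hl); specialize (Hg l Hl); lra.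
- intros eps He.
  destruct (has_sum_approx f a nil (eps / 2) Hf ltac:(lra)) as [l1 [_ [_ H1]]].
  destruct (has_sum_approx g b l1 (eps / 2) Hg ltac:(lra)) as [l2 [N2 [I2 H2]]].
  destruct (has_sum_approx f a l2 (eps / 2) Hf ltac:(lra)) as [l3 [N3 [I3 H3]]].
  exists l3; split; [exact N3|]. rewrite lsum_plus.
  pose proof (lsum_incl g l2 l3 (proj1 Hg) N2 I3). lra.
Qed.

Lemma has_sum_sum {T U} (f : T + U -> R) a b :
  has_sum (fun x => f (inl x)) a -> has_sum (fun x => f (inr x)) b ->
  has_sum f (a + b).
Proof.
intros [H0 [H1 H2]] [H0' [H1' H2']]; split; [|split].
- intros [x|x]; auto.
- intros l Hl.
  assert (Hs : exists l1 l2, NoDup l1 /\ NoDup l2 /\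
    (forall x, In x l1 -> In (inl x) l) /\ (forall x, In x l2 -> In (inr x) l) /\
    lsum f l = lsum (fun x => f (inl x)) l1 + lsum (fun x => f (inr x)) l2).
  { induction l as [|[x|x] l IH].
    - exists nil, nil; repeat split; try constructor; simpl; try tauto; lra.
    - inversion Hl; subst. destruct (IH ltac:(assumption)) as [l1 [l2 [N1 [N2 [I1 [I2 E]]]]]].
      exists (x :: l1), l2; repeat split; auto.
      + constructor; auto.
      + intros y [->|Hy]; [left|right]; auto.
      + intros y Hy; right; auto.
      + simpl. rewrite E. ring.
    - inversion Hl; subst. destruct (IH ltac:(assumption)) as [l1 [l2 [N1 [N2 [I1 [I2 E]]]]]].
      exists l1, (x :: l2); repeat split; auto.
      + constructor; auto.
      + intros y Hy; right; auto.
      + intros y [->|Hy]; [left|right]; auto.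
      + simpl. rewrite E. ring. }
  destruct Hs as [l1 [l2 [N1 [N2 [_ [_ ->]]]]]].
  apply Rplus_le_compat; auto.
- intros eps He.
  destruct (H2 (eps / 2) ltac:(lra)) as [l1 [N1 E1]].
  destruct (H2' (eps / 2) ltac:(lra)) as [l2 [N2 E2]].
  exists (map inl l1 ++ map inr l2); split.
  + apply NoDup_app.
    * apply Injective_map_NoDup; auto. intros x y E; injection E; auto.
    * apply Injective_map_NoDup; auto. intros x y E; injection E; auto.
    * intros x Hx Hy. apply in_map_iff in Hx, Hy.
      destruct Hx as [x1 [<- _]], Hy as [y1 [E _]]. discriminate.
  + rewrite lsum_app, !lsum_map. lra.
Qed.

Lemma lsum_const_mul {T U} (f : T -> R) (g : U -> R) l l' :
  lsum (fun p => f (fst p) * g (snd p)) (list_prod l l') = lsum f l * lsum g l'.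
Proof.
induction l as [|a l IH]; simpl; [ring|].
rewrite lsum_app, IH, lsum_map; simpl. rewrite lsum_scal. ring.
Qed.

Lemma NoDup_product {T U} (l : list T) (l' : list U) :
  NoDup l -> NoDup l' -> NoDup (list_prod l l').
Proof.
intros Hl Hl'; induction Hl as [|a l Ha Hl IH]; simpl; [constructor|].
apply NoDup_app; auto.
- apply Injective_map_NoDup; auto. intros x y E; injection E; auto.
- intros [x y] H1 H2. apply in_map_iff in H1. destruct H1 as [z [E _]].
  injection E as -> ->. apply in_prod_iff in H2. tauto.
Qed.

Lemma has_sum_prod {T U} (f : T -> R) (g : U -> R) a b :
  has_sum f a -> has_sum g b ->
  has_sum (fun p : T * U => f (fst p) * g (snd p)) (a * b).
Proof.
intros Hf Hg.
pose proof (has_sum_ge0 f a Hf) as Ha. pose proof (has_sum_ge0 g b Hg) as Hb.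
assert (H0 : forall p : T * U, 0 <= f (fst p) * g (snd p))
  by (intros p; apply Rmult_le_pos; [apply Hf|apply Hg]).
split; [exact H0|]; split.
- intros l Hl.
  destruct (nodup_exists (map fst l)) as [l1 [N1 [I1 _]]].
  destruct (nodup_exists (map snd l)) as [l2 [N2 [I2 _]]].
  apply Rle_trans with
    (lsum (fun p => f (fst p) * g (snd p)) (list_prod l1 l2)).
  + apply lsum_incl; auto. intros [x y] Hp. apply in_prod.
    * apply I1. apply (in_map fst) in Hp. exact Hp.
    * apply I2. apply (in_map snd) in Hp. exact Hp.
  + rewrite lsum_const_mul. apply Rmult_le_compat.
    * apply lsum_ge0, Hf.
    * apply lsum_ge0, Hg.
    * apply Hf, N1.
    * apply Hg, N2.
- intros eps He.
  set (d := eps / (a + b + 1)).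
  assert (Hd : 0 < d) by (apply Rdiv_lt_0_compat; lra).
  destruct Hf as [Hf0 [Hf1 Hf2]], Hg as [Hg0 [Hg1 Hg2]].
  destruct (Hf2 d Hd) as [l1 [N1 E1]]. destruct (Hg2 d Hd) as [l2 [N2 E2]].
  exists (list_prod l1 l2); split; [apply NoDup_product; auto|].
  rewrite lsum_const_mul.
  specialize (Hf1 l1 N1). specialize (Hg1 l2 N2).
  pose proof (lsum_ge0 f l1 Hf0). pose proof (lsum_ge0 g l2 Hg0).
  assert (d * (a + b + 1) = eps) by (unfold d; field; lra).
  nra.
Qed.

Lemma has_sum_finite {T} (f : T -> R) l : (forall x, 0 <= f x) -> NoDup l ->
  (forall x, f x <> 0 -> In x l) -> has_sum f (lsum f l).
Proof.
intros H0 Hl Hz; split; [exact H0|]; split.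
- intros l' Hl'. apply lsum_support; auto.
- intros eps He. exists l; split; [exact Hl|lra].
Qed.

Lemma lsum_lim {T} (f : nat -> T -> R) (g : T -> R) l :
  (forall x, is_lim_seq (fun n => f n x) (g x)) ->
  is_lim_seq (fun n => lsum (f n) l) (lsum g l).
Proof.
intros H; induction l as [|a l IH]; simpl.
- apply is_lim_seq_const.
- apply is_lim_seq_plus'; auto.
Qed.

(** [M - f] is nonnegative, so its finite sums grow with the list; what [f] leaves outside [l] is
    thus at most what [M] leaves there. *)
Lemma has_sum_tail {T} (f M : T -> R) s S l :
  has_sum f s -> has_sum M S -> (forall x, f x <= M x) -> NoDup l ->
  s - lsum f l <= S - lsum M l.
Proof.
intros Hf HM Hle Hl. apply Rnot_lt_le; intros Hlt.
set (d := (s - lsum f l) - (S - lsum M l)) in *.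
destruct (has_sum_approx f s l d Hf ltac:(unfold d; lra)) as [l' [N [I E]]].
assert (lsum M l' - lsum f l' >= lsum M l - lsum f l).
{ assert (G : forall k, lsum M k - lsum f k = lsum (fun x => M x - f x) k).
  { intros k; induction k as [|a k IH]; simpl; [ring|]. rewrite <- IH; ring. }
  rewrite !G. apply Rle_ge, lsum_incl; auto.
  intros x; specialize (Hle x); lra. }
destruct HM as [_ [HM _]]. specialize (HM l' N). unfold d in *; lra.
Qed.

(** Dominated convergence: one finite list carries all but eps/3 of the sum of the majorant, hence
    all but eps/3 of every [f n] and of [g]; on that list termwise convergence suffices. *)
Lemma tannery {T} (f : nat -> T -> R) (g M : T -> R) (s : nat -> R) (s' S : R) :
  has_sum M S -> (forall n, has_sum (f n) (s n)) -> has_sum g s' ->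
  (forall n x, f n x <= M x) ->
  (forall x, is_lim_seq (fun n => f n x) (g x)) -> is_lim_seq s s'.
Proof.
intros HM Hf Hg Hle Hlim.
assert (Hgle : forall x, g x <= M x).
{ intros x. apply (is_lim_seq_le (fun n => f n x) (fun _ => M x) (g x) (M x)); auto.
  apply is_lim_seq_const. }
apply is_lim_seq_spec. intros eps.
assert (He : 0 < eps / 3) by (destruct eps; simpl; lra).
destruct HM as [HM0 [HM1 HM2]]. destruct (HM2 (eps / 3) He) as [l [Hl E]].
pose proof (lsum_lim f g l Hlim) as HL. apply is_lim_seq_spec in HL.
destruct (HL (mkposreal _ He)) as [N HN]. exists N; intros n Hn.
specialize (HN n Hn). simpl in HN.
assert (HMs : has_sum M S) by (repeat split; auto).
pose proof (has_sum_tail (f n) M (s n) S l (Hf n) HMs (Hle n) Hl).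
pose proof (has_sum_tail g M s' S l Hg HMs Hgle Hl).
destruct Hg as [_ [Hg _]]. specialize (Hg l Hl).
destruct (Hf n) as [_ [Hfn _]]. specialize (Hfn l Hl).
apply Rabs_def1; apply Rabs_def2 in HN; lra.
Qed.

Lemma lsum_seq (f : nat -> R) n : lsum f (seq 0 (S n)) = sum_n f n.
Proof.
induction n as [|n IH].
- simpl. rewrite sum_O. ring.
- rewrite seq_S, lsum_app, IH, sum_Sn. simpl. unfold plus; simpl. ring.
Qed.

Lemma has_sum_series (f : nat -> R) s : (forall n, 0 <= f n) ->
  is_series f s -> has_sum f s.
Proof.
intros H0 Hs. unfold is_series in Hs.
assert (HL : is_lim_seq (sum_n f) s) by exact Hs.
assert (Hincr : forall n, sum_n f n <= s).
{ intros n. apply (is_lim_seq_incr_compare (sum_n f) s HL).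
  intros k. rewrite sum_Sn. unfold plus; simpl. specialize (H0 (S k)); lra. }
split; [exact H0|]; split.
- intros l Hl.
  apply Rle_trans with (2 := Hincr (list_max l)).
  rewrite <- lsum_seq. apply lsum_incl; auto.
  intros x Hx. apply in_seq.
  pose proof (proj1 (list_max_le l (list_max l)) (Nat.le_refl _)) as HF.
  rewrite Forall_forall in HF. specialize (HF x Hx). lia.
- intros eps He. apply is_lim_seq_spec in HL.
  destruct (HL (mkposreal eps He)) as [N HN].
  specialize (HN N (Nat.le_refl _)). simpl in HN. apply Rabs_def2 in HN.
  exists (seq 0 (S N)); split; [apply seq_NoDup|]. rewrite lsum_seq. lra.
Qed.

Lemma has_sum_bilateral (f : Z -> R) a b :
  has_sum (fun n => f (Z.of_nat n)) a ->
  has_sum (fun n => f (- Z.of_nat (S n))%Z) b -> has_sum f (a + b).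
Proof.
intros Ha Hb.
set (h := fun p : nat + nat => match p with
  | inl n => Z.of_nat n | inr n => (- Z.of_nat (S n))%Z end).
set (g := fun z : Z => if Z_le_dec 0 z then inl nat (Z.to_nat z)
  else inr nat (Z.to_nat (- z - 1))).
assert (H : has_sum (fun p => f (h p)) (a + b)) by (apply has_sum_sum; assumption).
apply (has_sum_bij g h) in H.
- apply has_sum_ext with (2 := H). intros z. f_equal. unfold g, h.
  destruct (Z_le_dec 0 z); lia.
- intros [n|n]; unfold g, h; destruct Z_le_dec; try lia; f_equal; lia.
- intros z; unfold g, h; destruct Z_le_dec; lia.
Qed.

Lemma has_sum_phi (q : R) : 0 < q < 1 ->
  has_sum (fun n : Z => powerRZ q (n * n)) (ramanujan_phi q).
Proof.
intros Hq.
destruct (ramanujan_phi_converges q) as [H1 H2]; [apply Rabs_def1; lra|].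
apply has_sum_bilateral; (apply has_sum_series;
  [intros n; apply powerRZ_le; lra|]); apply Series_correct; assumption.
Qed.

(** * Inversion of the theta function *)

(** This is binom(2m, m + i) / 4^m, the lazy walk with step weights 1/4, 1/2, 1/4. Laziness makes
    the eigenvalues of a step squares of cosines and removes any parity obstruction. *)
Fixpoint walk (m : nat) (i : Z) : R :=
  match m with
  | O => if Z.eq_dec i 0 then 1 else 0
  | S m => (walk m (i - 1) + 2 * walk m i + walk m (i + 1)) / 4
  end.

Lemma walk_ge0 m i : 0 <= walk m i.
Proof.
revert i; induction m as [|m IH]; intros i; simpl.
- destruct Z.eq_dec; lra.
- pose proof (IH (i - 1)%Z). pose proof (IH i). pose proof (IH (i + 1)%Z). lra.
Qed.

(** The quotient of neighbouring binomial coefficients, cleared of denominators so that it holds for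
    every integer [i], also outside the support. *)
Lemma walk_ratio m i :
  (INR m + IZR i + 1) * walk m (i + 1) = (INR m - IZR i) * walk m i.
Proof.
revert i; induction m as [|m IH]; intros i.
- simpl. destruct (Z.eq_dec (i + 1) 0) as [E|E], (Z.eq_dec i 0) as [E'|E']; try lia.
  + replace i with (-1)%Z by lia. simpl. lra.
  + rewrite E'. simpl. lra.
  + lra.
- rewrite S_INR. cbn [walk].
  replace (i + 1 - 1)%Z with i by lia.
  pose proof (IH i) as H0. pose proof (IH (i + 1)%Z) as H1. pose proof (IH (i - 1)%Z) as H2.
  replace (i - 1 + 1)%Z with i in H2 by lia.
  rewrite plus_IZR in H1. rewrite minus_IZR in H2.
  set (a := walk m (i - 1)) in *. set (b := walk m i) in *.
  set (d := walk m (i + 1)) in *. set (e := walk m (i + 1 + 1)) in *.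
  nra.
Qed.

Lemma walk_opp m i : walk m (- i) = walk m i.
Proof.
revert i; induction m as [|m IH]; intros i; simpl.
- destruct (Z.eq_dec (- i) 0), (Z.eq_dec i 0); try lia; reflexivity.
- replace (- i - 1)%Z with (- (i + 1))%Z by lia.
  replace (- i + 1)%Z with (- (i - 1))%Z by lia.
  rewrite !IH. field.
Qed.

Lemma walk_center m :
  walk (S m) 0 * (2 * INR m + 2) = (2 * INR m + 1) * walk m 0.
Proof.
cbn [walk]. pose proof (walk_ratio m 0) as H. pose proof (walk_opp m 1) as H'.
replace (0 - 1)%Z with (- (1))%Z by lia. rewrite H'.
replace (0 + 1)%Z with 1%Z in * by lia. simpl IZR in *. lra.
Qed.

Lemma walk_center_pos m : 0 < walk m 0.
Proof.
induction m as [|m IH].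
- simpl. lra.
- pose proof (walk_center m). pose proof (pos_INR m). nra.
Qed.

Lemma walk_step m i : (i < m)%nat ->
  walk m (Z.of_nat (S i)) =
  walk m (Z.of_nat i) * ((INR m - INR i) / (INR m + INR i + 1)).
Proof.
intros Hi. pose proof (walk_ratio m (Z.of_nat i)) as H.
rewrite <- INR_IZR_INZ in H. pose proof (pos_INR m). pose proof (pos_INR i).
replace (Z.of_nat (S i)) with (Z.of_nat i + 1)%Z by lia.
apply Rmult_eq_reg_l with (INR m + INR i + 1); [|lra].
rewrite H. field. lra.
Qed.

(** The quotient of neighbours is 1 - (2i+1)/(m+i+1), at most exp(-(2i+1)/(m+j)) as long as i < j;
    the odd numbers 1, 3, ..., 2i-1 add up to i^2. *)
Lemma walk_upper m j i : (i <= j <= m)%nat ->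
  walk m (Z.of_nat i) <= walk m 0 * exp (- (INR i ^ 2 / (INR m + INR j))).
Proof.
intros Hij. induction i as [|i IH].
- simpl. replace (- (0 * (0 * 1) / (INR m + INR j))) with 0.
  + rewrite exp_0; lra.
  + unfold Rdiv; ring.
- rewrite walk_step by lia.
  assert (Hj : (S i <= j)%nat) by lia. apply le_INR in Hj.
  assert (Hm : (j <= m)%nat) by lia. apply le_INR in Hm.
  rewrite S_INR in *. pose proof (pos_INR i).
  apply Rle_trans with
    (walk m 0 * exp (- (INR i ^ 2 / (INR m + INR j)))
     * exp (- ((2 * INR i + 1) / (INR m + INR j)))).
  + apply Rmult_le_compat.
    * apply walk_ge0.
    * apply Rmult_le_pos; [lra|]. apply Rlt_le, Rinv_0_lt_compat; lra.
    * apply IH; lia.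
    * apply Rle_trans with (1 + - ((2 * INR i + 1) / (INR m + INR j))).
      2: apply exp_ineq1_le.
      apply Rmult_le_reg_r with ((INR m + INR i + 1) * (INR m + INR j)); [nra|].
      field_simplify; [|lra|lra]. nra.
  + rewrite Rmult_assoc, <- exp_plus. apply Req_le. do 2 f_equal. field. lra.
Qed.

(** Same telescoping, with the quotient written as 1 / (1 + (2i+1)/(m-i)) and 1 + x <= exp x applied
    in the denominator. *)
Lemma walk_lower m j i : (i <= j < m)%nat ->
  walk m 0 * exp (- (INR i ^ 2 / (INR m - INR j))) <= walk m (Z.of_nat i).
Proof.
intros Hij. induction i as [|i IH].
- simpl. replace (- (0 * (0 * 1) / (INR m - INR j))) with 0.
  + rewrite exp_0; lra.
  + unfold Rdiv; ring.
- rewrite walk_step by lia.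
  assert (Hj : (S i <= j)%nat) by lia. apply le_INR in Hj.
  assert (Hm : (j < m)%nat) by lia. apply lt_INR in Hm.
  rewrite S_INR in *. pose proof (pos_INR i).
  apply Rle_trans with
    (walk m 0 * exp (- (INR i ^ 2 / (INR m - INR j)))
     * exp (- ((2 * INR i + 1) / (INR m - INR j)))).
  + rewrite Rmult_assoc, <- exp_plus. apply Req_le. do 2 f_equal. field. lra.
  + apply Rmult_le_compat.
    * apply Rmult_le_pos; [apply walk_ge0|apply Rlt_le, exp_pos].
    * apply Rlt_le, exp_pos.
    * apply IH; lia.
    * rewrite exp_Ropp.
      replace ((INR m - INR i) / (INR m + INR i + 1))
        with (/ (1 + (2 * INR i + 1) / (INR m - INR i))) by (field; lra).
      apply Rinv_le_contravar.
      { assert (0 <= (2 * INR i + 1) / (INR m - INR i)); [|lra].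
        apply Rmult_le_pos; [lra|]. apply Rlt_le, Rinv_0_lt_compat; lra. }
      apply Rle_trans with (1 + (2 * INR i + 1) / (INR m - INR j)).
      2: apply exp_ineq1_le.
      apply Rplus_le_compat_l, Rmult_le_compat_l; [lra|].
      apply Rinv_le_contravar; lra.
Qed.

Lemma walk_zero m j : (m < j)%nat -> walk m (Z.of_nat j) = 0.
Proof.
intros Hj. induction Hj as [|j Hj IH].
- pose proof (walk_ratio m (Z.of_nat m)) as H. rewrite <- INR_IZR_INZ in H.
  pose proof (pos_INR m). replace (Z.of_nat (S m)) with (Z.of_nat m + 1)%Z by lia.
  nra.
- pose proof (walk_ratio m (Z.of_nat j)) as H. rewrite IH, <- INR_IZR_INZ in H.
  pose proof (pos_INR m). pose proof (pos_INR j).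
  replace (Z.of_nat (S j)) with (Z.of_nat j + 1)%Z by lia.
  nra.
Qed.

(** The choice j = m in [walk_upper] loses a factor 2 in the exponent but covers all distances; this
    bound provides the majorant in [lim_walk_side]. *)
Lemma walk_gauss m i : (0 < m)%nat ->
  walk m i <= walk m 0 * exp (- (IZR i ^ 2 / (2 * INR m))).
Proof.
intros Hm.
assert (G : forall j : nat, walk m (Z.of_nat j) <=
  walk m 0 * exp (- (INR j ^ 2 / (2 * INR m)))).
{ intros j. destruct (le_lt_dec j m) as [H|H].
  - apply Rle_trans with (1 := walk_upper m m j ltac:(lia)).
    apply Req_le. do 4 f_equal. ring.
  - rewrite walk_zero by exact H. apply Rmult_le_pos; [apply walk_ge0|].
    apply Rlt_le, exp_pos. }
destruct (Z_le_dec 0 i) as [H|H].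
- specialize (G (Z.to_nat i)). rewrite INR_IZR_INZ, Z2Nat.id in G by lia. exact G.
- specialize (G (Z.to_nat (- i))). rewrite INR_IZR_INZ, Z2Nat.id in G by lia.
  rewrite walk_opp, opp_IZR in G. replace (IZR i ^ 2) with ((- IZR i) ^ 2) by ring.
  exact G.
Qed.

(** Return probabilities of the walk on the cycle of length [2 N + 1], diagonalised by cosines. *)
Definition cyc (N m : nat) (j : Z) : R :=
  (1 + 2 * lsum (fun k => cos (PI * INR k / INR (2 * N + 1)) ^ (2 * m)
                  * cos (2 * (PI * INR k / INR (2 * N + 1)) * IZR j)) (seq 1 N))
  / INR (2 * N + 1).

Lemma dirichlet_kernel x N :
  sin x * (1 + 2 * lsum (fun k => cos (2 * INR k * x)) (seq 1 N))
  = sin (INR (2 * N + 1) * x).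
Proof.
induction N as [|N IH].
- change (INR (2 * 0 + 1)) with 1. rewrite (Rmult_1_l x). simpl. ring.
- rewrite seq_S, lsum_app.
  replace (1 + N)%nat with (S N) by lia.
  transitivity (sin (INR (2 * N + 1) * x) + 2 * sin x * cos (2 * INR (S N) * x)).
  + rewrite <- IH. cbn [lsum fold_right]. ring.
  + replace (INR (2 * N + 1)) with (2 * INR (S N) - 1)
      by (rewrite plus_INR, mult_INR, S_INR; simpl INR; ring).
    replace (INR (2 * S N + 1)) with (2 * INR (S N) + 1)
      by (rewrite plus_INR, mult_INR; simpl (INR 2); simpl (INR 1); ring).
    replace ((2 * INR (S N) - 1) * x) with (2 * INR (S N) * x - x) by ring.
    replace ((2 * INR (S N) + 1) * x) with (2 * INR (S N) * x + x) by ring.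
    rewrite sin_plus, sin_minus. ring.
Qed.

Lemma sin_IZR_PI k : sin (IZR k * PI) = 0.
Proof. apply sin_eq_0_1. exists k; reflexivity. Qed.

Lemma cos_IZR_2PI k : cos (2 * (IZR k * PI)) = 1.
Proof. rewrite cos_2a_sin, sin_IZR_PI. ring. Qed.

Lemma lsum_ext_in {T} (f g : T -> R) l :
  (forall x, In x l -> f x = g x) -> lsum f l = lsum g l.
Proof.
intros H; induction l as [|a l IH]; simpl; [reflexivity|].
rewrite IH, (H a); auto; [left; reflexivity|]. intros x Hx; apply H; right; exact Hx.
Qed.

Lemma lsum_one {T} (l : list T) : lsum (fun _ => 1) l = INR (length l).
Proof.
induction l as [|a l IH]; [reflexivity|]. simpl lsum. rewrite IH.
change (length (a :: l)) with (S (length l)). rewrite S_INR. ring.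
Qed.

(** At time 0 the cosine sum is a Dirichlet kernel at x = PI j / L, where L = 2N+1. If L divides j
    all cosines are 1; otherwise sin (L x) = sin (PI j) = 0 while sin x is nonzero, so the kernel
    vanishes. *)
Lemma cyc_0 N j : cyc N 0 j =
  if Z.eq_dec (j mod Z.of_nat (2 * N + 1)) 0 then 1 else 0.
Proof.
unfold cyc. set (l := (2 * N + 1)%nat).
assert (Hl : 0 < INR l) by (apply lt_0_INR; unfold l; lia).
set (x := PI * IZR j / INR l).
rewrite (lsum_ext _ (fun k => cos (2 * INR k * x))).
2: { intros k. rewrite Nat.mul_0_r. simpl pow. rewrite Rmult_1_l. f_equal.
  unfold x; field; lra. }
destruct Z.eq_dec as [E|E].
- apply Z_div_exact_full_2 in E; [|unfold l; lia].
  set (d := (j / Z.of_nat l)%Z) in *.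
  rewrite (lsum_ext _ (fun _ => 1)).
  + rewrite lsum_one, length_seq. unfold l. rewrite plus_INR, mult_INR. simpl INR.
    field. pose proof (pos_INR N); lra.
  + intros k. rewrite <- (cos_IZR_2PI (Z.of_nat k * d)). f_equal.
    unfold x. rewrite E, !mult_IZR, <- !INR_IZR_INZ. field. lra.
- pose proof (dirichlet_kernel x N) as H. fold l in H.
  replace (INR l * x) with (IZR j * PI) in H by (unfold x; field; lra).
  rewrite sin_IZR_PI in H. apply Rmult_integral in H. destruct H as [H|H].
  + exfalso; apply E. destruct (sin_eq_0_0 x H) as [k Hk].
    assert (Hj : IZR j = IZR (Z.of_nat l * k)).
    { rewrite mult_IZR, <- INR_IZR_INZ. pose proof PI_RGT_0.
      apply Rmult_eq_reg_l with (PI / INR l).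
      - transitivity x; [unfold x; field; lra|]. rewrite Hk. field. lra.
      - apply Rgt_not_eq, Rdiv_lt_0_compat; lra. }
    apply eq_IZR in Hj. rewrite Hj. rewrite Z.mul_comm. apply Z_mod_mult.
  + rewrite H. unfold Rdiv; ring.
Qed.

(** Since cos(A - 2h) + 2 cos A + cos(A + 2h) = 4 (cos h)^2 cos A, each frequency is an eigenvector
    of the step with eigenvalue (cos h)^2. *)
Lemma cyc_S N m j :
  cyc N (S m) j = (cyc N m (j - 1) + 2 * cyc N m j + cyc N m (j + 1)) / 4.
Proof.
unfold cyc. set (L := INR (2 * N + 1)).
assert (HL : 0 < L) by (apply lt_0_INR; lia).
set (th := fun k => PI * INR k / L).
set (F := fun (m : nat) (j : Z) k => cos (th k) ^ (2 * m) * cos (2 * th k * IZR j)).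
change ((1 + 2 * lsum (F (S m) j) (seq 1 N)) / L =
 ((1 + 2 * lsum (F m (j - 1)%Z) (seq 1 N)) / L + 2 * ((1 + 2 * lsum (F m j) (seq 1 N)) / L)
  + (1 + 2 * lsum (F m (j + 1)%Z) (seq 1 N)) / L) / 4).
assert (E : lsum (F (S m) j) (seq 1 N) =
  (lsum (F m (j - 1)%Z) (seq 1 N) + 2 * lsum (F m j) (seq 1 N)
   + lsum (F m (j + 1)%Z) (seq 1 N)) / 4).
{ set (l := seq 1 N). clearbody l. induction l as [|k l IH]; simpl lsum; [field|].
  rewrite IH.
  assert (E : F (S m) j k = (F m (j - 1)%Z k + 2 * F m j k + F m (j + 1)%Z k) / 4).
  { unfold F. rewrite minus_IZR, plus_IZR.
    replace (2 * th k * (IZR j - 1)) with (2 * th k * IZR j - 2 * th k) by ring.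
    replace (2 * th k * (IZR j + 1)) with (2 * th k * IZR j + 2 * th k) by ring.
    rewrite cos_plus, cos_minus, (cos_2a_cos (th k)).
    replace (2 * S m)%nat with (2 * m + 2)%nat by lia. rewrite pow_add. field. }
  rewrite E. field. }
rewrite E. field. lra.
Qed.

(** The walk on the integers wound around the cycle: both sides obey the same recursion in [m] and
    agree at [m = 0]. It is an exact, finite form of Poisson summation, whose scaling limit is
    [theta_inversion]. *)
Lemma walk_cyc N m j :
  has_sum (fun nu : Z => walk m (j + Z.of_nat (2 * N + 1) * nu)) (cyc N m j).
Proof.
revert j; induction m as [|m IH]; intros j.
- rewrite cyc_0. set (l := Z.of_nat (2 * N + 1)).
  assert (Hl : (0 < l)%Z) by (unfold l; lia).
  destruct Z.eq_dec as [E|E].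
  + apply Z_div_exact_full_2 in E; [|lia]. set (d := (j / l)%Z) in *.
    replace 1 with (lsum (fun nu : Z => walk 0 (j + l * nu)) (- d :: nil)%Z).
    * apply has_sum_finite.
      -- intros; apply walk_ge0.
      -- constructor; [intros []|constructor].
      -- intros nu. simpl. destruct Z.eq_dec as [E'|E']; [|lra]. intros _. left. nia.
    * simpl. destruct Z.eq_dec as [E'|E']; [ring|]. exfalso; lia.
  + apply (has_sum_finite _ nil).
    * intros; apply walk_ge0.
    * constructor.
    * intros nu. simpl. destruct Z.eq_dec as [E'|E']; [|lra]. exfalso; apply E.
      replace j with ((- nu) * l)%Z by lia. apply Z_mod_mult.
- rewrite cyc_S.
  pose proof (IH (j - 1)%Z) as H1. pose proof (has_sum_scal 2 _ _ ltac:(lra) (IH j)) as H2.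
  pose proof (IH (j + 1)%Z) as H3.
  pose proof (has_sum_scal (/ 4) _ _ ltac:(lra) (has_sum_plus _ _ _ _ (has_sum_plus _ _ _ _ H1 H2) H3)) as H.
  unfold Rdiv. rewrite Rmult_comm. apply has_sum_ext with (2 := H).
  intros nu. cbn [walk].
  set (w := (Z.of_nat (2 * N + 1) * nu)%Z).
  replace (j - 1 + w)%Z with (j + w - 1)%Z by lia.
  replace (j + 1 + w)%Z with (j + w + 1)%Z by lia. field.
Qed.

Lemma has_sum_gauss a : 0 < a ->
  has_sum (fun k : Z => exp (- (a * IZR k ^ 2))) (ramanujan_phi (exp (- a))).
Proof.
intros Ha. apply (has_sum_ext (fun k : Z => powerRZ (exp (- a)) (k * k))).
- intros k. rewrite powerRZ_Rpower by apply exp_pos. unfold Rpower.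
  rewrite ln_exp, mult_IZR. f_equal. ring.
- apply has_sum_phi. split; [apply exp_pos|]. rewrite <- exp_0. apply exp_increasing. lra.
Qed.

(** * Scaling limits of the two expressions for the return probability *)

Definition ell (N : nat) : R := INR (2 * N + 1).
(** Diffusive scaling: time proportional to the squared length. [up] rounds strictly upwards, by at
    most 1. *)
Definition steps (c : R) (N : nat) : nat := Z.to_nat (up (c * ell N ^ 2)).

Lemma ell_ge1 N : 1 <= ell N.
Proof. unfold ell. apply (le_INR 1). lia. Qed.

Lemma steps_bounds c N : 0 < c ->
  c * ell N ^ 2 < INR (steps c N) <= c * ell N ^ 2 + 1.
Proof.
intros Hc. pose proof (ell_ge1 N). destruct (archimed (c * ell N ^ 2)) as [H1 H2].
assert (0 < c * ell N ^ 2) by (apply Rmult_lt_0_compat; [|apply pow_lt]; lra).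
unfold steps. rewrite INR_IZR_INZ, Z2Nat.id; [lra|].
apply le_IZR. lra.
Qed.

Lemma steps_pos c N : 0 < c -> (0 < steps c N)%nat.
Proof.
intros Hc. apply INR_lt. simpl. pose proof (steps_bounds c N Hc).
pose proof (ell_ge1 N).
assert (0 < c * ell N ^ 2) by (apply Rmult_lt_0_compat; [|apply pow_lt]; lra). lra.
Qed.

Lemma lim_ell : is_lim_seq ell p_infty.
Proof.
apply is_lim_seq_le_p_loc with INR; [|apply is_lim_seq_INR].
exists O; intros n _. unfold ell. apply le_INR. lia.
Qed.

Lemma lim_inv_ell : is_lim_seq (fun N => / ell N) 0.
Proof. apply (is_lim_seq_inv ell p_infty); [apply lim_ell|discriminate]. Qed.

Lemma lim_steps_ratio c : 0 < c -> is_lim_seq (fun N => INR (steps c N) / ell N ^ 2) c.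
Proof.
intros Hc. apply (is_lim_seq_le_le (fun _ => c) _ (fun N => c + / ell N * / ell N)).
- intros N. pose proof (steps_bounds c N Hc). pose proof (ell_ge1 N).
  split.
  + apply Rmult_le_reg_r with (ell N ^ 2); [nra|]. field_simplify; lra.
  + apply Rmult_le_reg_r with (ell N ^ 2); [nra|]. field_simplify; lra.
- apply is_lim_seq_const.
- replace (Finite c) with (Finite (c + 0 * 0)) by (f_equal; ring).
  apply is_lim_seq_plus'; [apply is_lim_seq_const|].
  apply is_lim_seq_mult'; apply lim_inv_ell.
Qed.

Lemma lim_steps c : 0 < c -> filterlim (steps c) eventually eventually.
Proof.
intros Hc P [M HM].
assert (HL : is_lim_seq (fun N => c * ell N) p_infty).
{ apply is_lim_seq_ext with (fun N => ell N * c); [intros; ring|].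
  apply (is_lim_seq_mult ell (fun _ => c) p_infty c p_infty);
    [apply lim_ell|apply is_lim_seq_const|].
  unfold is_Rbar_mult; simpl. destruct Rle_dec as [H|H]; [|lra].
  destruct Rle_lt_or_eq_dec; [reflexivity|lra]. }
apply is_lim_seq_spec in HL. destruct (HL (INR M)) as [N0 HN].
exists N0; intros N HN0. apply HM. specialize (HN N HN0).
apply INR_le. pose proof (steps_bounds c N Hc). pose proof (ell_ge1 N).
assert (c * ell N <= c * ell N ^ 2) by (apply Rmult_le_compat_l; nra). lra.
Qed.

Lemma lim_ell_sin a : is_lim_seq (fun N => ell N * sin (a / ell N)) a.
Proof.
destruct (Req_dec a 0) as [->|Ha].
- apply is_lim_seq_ext with (fun _ => 0); [|apply is_lim_seq_const].
  intros N. unfold Rdiv. rewrite Rmult_0_l, sin_0. ring.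
- apply is_lim_seq_ext with (fun N => a * (sin (a / ell N) / (a / ell N))).
  { intros N. pose proof (ell_ge1 N). field. lra. }
  replace (Finite a) with (Finite (a * 1)) by (f_equal; ring).
  apply is_lim_seq_mult'; [apply is_lim_seq_const|].
  apply (is_lim_comp_seq (fun x => sin x / x) (fun N => a / ell N) 0 1).
  + apply is_lim_sinc_0.
  + exists O; intros N _ E. injection E as E. pose proof (ell_ge1 N).
    apply (Rmult_eq_compat_r (ell N)) in E. field_simplify in E; lra.
  + replace (Finite 0) with (Finite (a * 0)) by (f_equal; ring).
    apply is_lim_seq_mult'; [apply is_lim_seq_const|apply lim_inv_ell].
Qed.

Lemma lim_exp_opp (u : nat -> R) (a : R) : is_lim_seq u a ->
  is_lim_seq (fun n => exp (- u n)) (exp (- a)).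
Proof.
intros H. apply (is_lim_seq_continuous (fun x => exp (- x)) u a); [|exact H].
apply derivable_continuous_pt, derivable_pt_comp; [apply derivable_pt_opp|].
2: apply derivable_pt_exp. apply derivable_pt_id.
Qed.

Lemma pow_one_minus y m : 0 <= y <= 1 -> (1 - y) ^ m <= exp (- (INR m * y)).
Proof.
intros Hy. induction m as [|m IH].
- simpl. rewrite Rmult_0_l, Ropp_0, exp_0. lra.
- rewrite S_INR. simpl pow.
  replace (- ((INR m + 1) * y)) with (- y + - (INR m * y)) by ring.
  rewrite exp_plus. apply Rmult_le_compat; try lra.
  + apply pow_le; lra.
  + pose proof (exp_ineq1_le (- y)); lra.
Qed.

Lemma pow_one_minus_lower y m : 0 <= y < 1 ->
  exp (- (INR m * y / (1 - y))) <= (1 - y) ^ m.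
Proof.
intros Hy. induction m as [|m IH].
- simpl. unfold Rdiv. rewrite !Rmult_0_l, Ropp_0, exp_0. lra.
- rewrite S_INR. simpl pow.
  replace (- ((INR m + 1) * y / (1 - y)))
    with (- (y / (1 - y)) + - (INR m * y / (1 - y))) by (field; lra).
  rewrite exp_plus. apply Rmult_le_compat; try apply Rlt_le, exp_pos; [|exact IH].
  rewrite exp_Ropp. replace (1 - y) with (/ (1 + y / (1 - y))) at 2 by (field; lra).
  assert (0 <= y / (1 - y)).
  { apply Rmult_le_pos; [lra|]. apply Rlt_le, Rinv_0_lt_compat; lra. }
  apply Rinv_le_contravar; [lra|]. apply exp_ineq1_le.
Qed.

Lemma cos_pow_double x m : cos x ^ (2 * m) = (1 - sin x ^ 2) ^ m.
Proof. rewrite pow_mult. f_equal. pose proof (sin2_cos2 x). unfold Rsqr in H. nra. Qed.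

Lemma sin_sqr_bounds x : 0 <= sin x ^ 2 <= 1.
Proof. pose proof (SIN_bound x). nra. Qed.

Lemma lim_cos_pow c a : 0 < c ->
  is_lim_seq (fun N => cos (a / ell N) ^ (2 * steps c N)) (exp (- (c * a ^ 2))).
Proof.
intros Hc.
set (y := fun N => sin (a / ell N) ^ 2).
assert (Hy : is_lim_seq y 0).
{ apply is_lim_seq_ext with
    (fun N => (ell N * sin (a / ell N)) * (ell N * sin (a / ell N)) * (/ ell N * / ell N)).
  { intros N. unfold y. pose proof (ell_ge1 N). field. lra. }
  replace (Finite 0) with (Finite ((a * a) * (0 * 0))) by (f_equal; ring).
  apply is_lim_seq_mult'; apply is_lim_seq_mult';
    apply lim_ell_sin || apply lim_inv_ell. }
assert (Hmy : is_lim_seq (fun N => INR (steps c N) * y N) (c * a ^ 2)).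
{ apply is_lim_seq_ext with
    (fun N => (INR (steps c N) / ell N ^ 2) *
      ((ell N * sin (a / ell N)) * (ell N * sin (a / ell N)))).
  { intros N. unfold y. pose proof (ell_ge1 N). field. lra. }
  replace (a ^ 2) with (a * a) by ring.
  apply is_lim_seq_mult'; [apply lim_steps_ratio; exact Hc|].
  apply is_lim_seq_mult'; apply lim_ell_sin. }
apply is_lim_seq_le_le_loc with
  (fun N => exp (- (INR (steps c N) * y N / (1 - y N))))
  (fun N => exp (- (INR (steps c N) * y N))).
- pose proof Hy as Hy'. apply is_lim_seq_spec in Hy'.
  destruct (Hy' (mkposreal 1 Rlt_0_1)) as [n0 Hn]. exists n0; intros N HN.
  specialize (Hn N HN). simpl in Hn. apply Rabs_def2 in Hn.
  rewrite cos_pow_double. fold (y N). pose proof (sin_sqr_bounds (a / ell N)) as Hb.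
  fold (y N) in Hb. split.
  + apply pow_one_minus_lower; lra.
  + apply pow_one_minus; lra.
- apply lim_exp_opp.
  replace (c * a ^ 2) with (c * a ^ 2 / (1 - 0)) by field.
  apply is_lim_seq_div'; [exact Hmy| |lra].
  apply is_lim_seq_minus'; [apply is_lim_seq_const|exact Hy].
- apply lim_exp_opp, Hmy.
Qed.

(** From sin x >= x - x^3/6 and x <= PI/2 <= 2. The crude constant only has to provide a summable
    majorant. *)
Lemma sin_third x : 0 <= x <= PI / 2 -> x / 3 <= sin x.
Proof.
intros Hx. pose proof PI_4. pose proof PI_RGT_0.
destruct (sin_bound x 0 ltac:(lra) ltac:(lra)) as [H1 _].
apply Rle_trans with (2 := H1). unfold sin_approx, sin_term; simpl.
assert (x * x <= 4) by nra. nra.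
Qed.

Lemma sin_sqr_lower x : Rabs x <= PI / 2 -> x ^ 2 / 9 <= sin x ^ 2.
Proof.
intros Hx. destruct (Rle_dec 0 x) as [H|H].
- rewrite Rabs_pos_eq in Hx by lra. pose proof (sin_third x ltac:(lra)). nra.
- rewrite Rabs_left in Hx by lra. pose proof (sin_third (- x) ltac:(lra)) as Hs.
  rewrite sin_neg in Hs. nra.
Qed.

(** The frequencies of [cyc] unfolded to both signs and extended by 0, so that [tannery] applies
    over an index type that does not depend on [N]. *)
Definition cos_term (c : R) (N : nat) (k : Z) : R :=
  if Z_le_dec (Z.abs k) (Z.of_nat N)
  then cos (PI * IZR k / ell N) ^ (2 * steps c N) else 0.

Lemma cos_term_sum c N :
  has_sum (cos_term c N) (ell N * cyc N (steps c N) 0).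
Proof.
set (F := fun k => cos (PI * INR k / ell N) ^ (2 * steps c N)).
set (l := (0 :: map Z.of_nat (seq 1 N) ++ map (fun n => - Z.of_nat n) (seq 1 N))%Z).
assert (E1 : forall k, (k <= N)%nat -> cos_term c N (Z.of_nat k) = F k).
{ intros k Hk. unfold cos_term. destruct Z_le_dec; [|lia].
  rewrite <- INR_IZR_INZ. reflexivity. }
assert (E2 : forall k, (k <= N)%nat -> cos_term c N (- Z.of_nat k) = F k).
{ intros k Hk. unfold cos_term. destruct Z_le_dec; [|lia].
  rewrite opp_IZR, <- INR_IZR_INZ. unfold F. rewrite <- (cos_neg (PI * INR k / ell N)).
  do 2 f_equal. unfold Rdiv; ring. }
replace (ell N * cyc N (steps c N) 0) with (lsum (cos_term c N) l).
- apply has_sum_finite.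
  + intros k. unfold cos_term. destruct Z_le_dec; [|lra].
    rewrite pow_mult. apply pow_le. apply pow2_ge_0.
  + unfold l. constructor.
    * intros Hi. apply in_app_or in Hi. destruct Hi as [Hi|Hi];
        apply in_map_iff in Hi; destruct Hi as [x [E Hx]]; apply in_seq in Hx; lia.
    * apply NoDup_app.
      -- apply Injective_map_NoDup; [intros x y; lia|apply seq_NoDup].
      -- apply Injective_map_NoDup; [intros x y; lia|apply seq_NoDup].
      -- intros x Hx Hy. apply in_map_iff in Hx, Hy.
         destruct Hx as [x1 [Ex Hx]], Hy as [y1 [Ey Hy]].
         apply in_seq in Hx, Hy. lia.
  + intros k. unfold cos_term. destruct Z_le_dec as [H|H]; [|lra]. intros _.
    destruct (Z_lt_le_dec k 0) as [Hk|Hk]; [|destruct (Z.eq_dec k 0) as [E|E]].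
    * right. apply in_or_app. right. apply in_map_iff. exists (Z.to_nat (- k)).
      split; [lia|]. apply in_seq. lia.
    * left; auto.
    * right. apply in_or_app. left. apply in_map_iff. exists (Z.to_nat k).
      split; [lia|]. apply in_seq. lia.
- unfold l. simpl lsum. rewrite lsum_app, !lsum_map.
  rewrite (lsum_ext_in _ F) by (intros x Hx; apply in_seq in Hx; apply E1; lia).
  rewrite (lsum_ext_in (fun x => cos_term c N (- Z.of_nat x)) F)
    by (intros x Hx; apply in_seq in Hx; apply E2; lia).
  change 0%Z with (Z.of_nat 0) at 1. rewrite E1 by lia.
  unfold cyc. fold (ell N).
  rewrite (lsum_ext (fun k => cos (PI * INR k / ell N) ^ (2 * steps c N) * _) F).
  + pose proof (ell_ge1 N). field_simplify; [|lra].
    assert (F 0%nat = 1); [|lra]. unfold F. simpl INR.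
    replace (PI * 0 / ell N) with 0 by (field; lra). rewrite cos_0. apply pow1.
  + intros k. rewrite Rmult_0_r, cos_0. unfold F; ring.
Qed.

Lemma lim_cos_side c : 0 < c ->
  is_lim_seq (fun N => ell N * cyc N (steps c N) 0)
    (ramanujan_phi (exp (- (c * PI ^ 2)))).
Proof.
intros Hc. pose proof PI_RGT_0 as Hpi.
assert (Hcp : 0 < c * PI ^ 2) by (apply Rmult_lt_0_compat; [|apply pow_lt]; lra).
apply (tannery (cos_term c) (fun k => exp (- (c * PI ^ 2 * IZR k ^ 2)))
  (fun k => exp (- (c * PI ^ 2 / 9 * IZR k ^ 2))) _ _
  (ramanujan_phi (exp (- (c * PI ^ 2 / 9))))).
- apply has_sum_gauss. lra.
- apply cos_term_sum.
- apply has_sum_gauss. lra.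
- intros N k. unfold cos_term. destruct Z_le_dec as [H|H]; [|apply Rlt_le, exp_pos].
  rewrite cos_pow_double.
  apply Rle_trans with (1 := pow_one_minus _ _ (sin_sqr_bounds _)).
  set (x := PI * IZR k / ell N). pose proof (ell_ge1 N) as Hl.
  assert (Hk : Rabs (IZR k) <= INR N).
  { rewrite <- abs_IZR, INR_IZR_INZ. apply IZR_le, H. }
  (* The cutoff |k| <= N keeps the angle where sin^2 x >= x^2/9; this is the 9 of the majorant. *)
  assert (Hx : Rabs x <= PI / 2).
  { unfold x, Rdiv. rewrite !Rabs_mult, Rabs_inv, (Rabs_pos_eq PI), (Rabs_pos_eq (ell N)) by lra.
    rewrite Rmult_assoc. apply Rmult_le_compat_l; [lra|].
    apply Rmult_le_reg_r with (ell N); [lra|].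
    rewrite Rmult_assoc, Rinv_l, Rmult_1_r by lra.
    unfold ell in *. rewrite plus_INR, mult_INR in *. simpl INR in *. lra. }
  pose proof (sin_sqr_lower x Hx) as Hs. pose proof (steps_bounds c N Hc) as Hm.
  assert (Hle : c * PI ^ 2 / 9 * IZR k ^ 2 <= INR (steps c N) * sin x ^ 2).
  { apply Rle_trans with (c * ell N ^ 2 * (x ^ 2 / 9)).
    - apply Req_le. unfold x. field. lra.
    - apply Rmult_le_compat; try lra.
      + apply Rmult_le_pos; [lra|apply pow2_ge_0].
      + pose proof (pow2_ge_0 x). lra. }
  destruct (Rle_lt_or_eq_dec _ _ Hle) as [Hlt|Heq].
  + apply Rlt_le, exp_increasing. lra.
  + rewrite Heq. lra.
- intros k. apply is_lim_seq_ext_loc with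
    (fun N => cos (PI * IZR k / ell N) ^ (2 * steps c N)).
  + exists (Z.to_nat (Z.abs k)). intros N HN. unfold cos_term.
    destruct Z_le_dec; [reflexivity|lia].
  + replace (c * PI ^ 2 * IZR k ^ 2) with (c * (PI * IZR k) ^ 2) by ring.
    apply lim_cos_pow, Hc.
Qed.

Lemma lim_walk_ratio c k : 0 < c ->
  is_lim_seq (fun N => walk (steps c N) (Z.of_nat ((2 * N + 1) * k)) / walk (steps c N) 0)
    (exp (- (/ c * INR k ^ 2))).
Proof.
intros Hc.
assert (Hm : is_lim_seq (fun N => INR k * / ell N) 0).
{ replace (Finite 0) with (Finite (INR k * 0)) by (f_equal; ring).
  apply is_lim_seq_mult'; [apply is_lim_seq_const|apply lim_inv_ell]. }
pose proof (lim_steps_ratio c Hc) as Hr.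
assert (Hj : forall N, INR ((2 * N + 1) * k) = ell N * INR k)
  by (intros; rewrite mult_INR; reflexivity).
apply is_lim_seq_le_le_loc with
  (fun N => exp (- (INR ((2 * N + 1) * k) ^ 2 / (INR (steps c N) - INR ((2 * N + 1) * k)))))
  (fun N => exp (- (INR ((2 * N + 1) * k) ^ 2 / (INR (steps c N) + INR ((2 * N + 1) * k))))).
- apply is_lim_seq_spec in Hm. destruct (Hm (mkposreal c Hc)) as [N0 HN].
  exists N0; intros N HN0. specialize (HN N HN0). simpl in HN.
  apply Rabs_def2 in HN. pose proof (ell_ge1 N). pose proof (steps_bounds c N Hc).
  assert (Hlt : ((2 * N + 1) * k < steps c N)%nat).
  { apply INR_lt. rewrite Hj. apply Rle_lt_trans with (c * ell N ^ 2); [|lra].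
    replace (ell N * INR k) with (INR k * / ell N * ell N ^ 2) by (field; lra).
    apply Rmult_le_compat_r; [apply pow2_ge_0|lra]. }
  pose proof (walk_center_pos (steps c N)) as Hw.
  split.
  + apply Rle_div_r; [exact Hw|]. rewrite Rmult_comm. apply walk_lower; lia.
  + apply Rle_div_l; [exact Hw|]. rewrite Rmult_comm. apply walk_upper; lia.
- apply lim_exp_opp.
  apply is_lim_seq_ext_loc with
    (fun N => INR k ^ 2 / (INR (steps c N) / ell N ^ 2 - INR k * / ell N)).
  { pose proof (is_lim_seq_minus' _ _ _ _ Hr Hm) as Hd. apply is_lim_seq_spec in Hd.
    destruct (Hd (mkposreal c Hc)) as [N0 HN]. exists N0; intros N HN0.
    specialize (HN N HN0). cbn [pos] in HN. apply Rabs_def2 in HN.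
    pose proof (ell_ge1 N). rewrite Hj.
    set (d := INR (steps c N) / ell N ^ 2 - INR k * / ell N) in *.
    assert (E : INR (steps c N) - ell N * INR k = d * ell N ^ 2)
      by (unfold d; field; lra).
    rewrite E. field. split; lra. }
  replace (/ c * INR k ^ 2) with (INR k ^ 2 / (c - 0)) by (field; lra).
  apply is_lim_seq_div'; [apply is_lim_seq_const| |lra].
  apply is_lim_seq_minus'; assumption.
- apply lim_exp_opp.
  apply is_lim_seq_ext with
    (fun N => INR k ^ 2 / (INR (steps c N) / ell N ^ 2 + INR k * / ell N)).
  { intros N. pose proof (ell_ge1 N). rewrite Hj. pose proof (pos_INR k).
    pose proof (lt_0_INR _ (steps_pos c N Hc)).
    field. repeat split; try lra; nra. }
  replace (/ c * INR k ^ 2) with (INR k ^ 2 / (c + 0)) by (field; lra).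
  apply is_lim_seq_div'; [apply is_lim_seq_const| |lra].
  apply is_lim_seq_plus'; assumption.
Qed.

Lemma lim_walk_side c : 0 < c ->
  is_lim_seq (fun N => cyc N (steps c N) 0 / walk (steps c N) 0)
    (ramanujan_phi (exp (- / c))).
Proof.
intros Hc.
assert (Hic : 0 < / c) by (apply Rinv_0_lt_compat, Hc).
apply (tannery
  (fun N (nu : Z) => / walk (steps c N) 0 * walk (steps c N) (0 + Z.of_nat (2 * N + 1) * nu))
  (fun k => exp (- (/ c * IZR k ^ 2)))
  (fun k => exp (- (/ (2 * (c + 1)) * IZR k ^ 2))) _ _
  (ramanujan_phi (exp (- / (2 * (c + 1)))))).
- apply has_sum_gauss, Rinv_0_lt_compat. lra.
- intros N. unfold Rdiv. rewrite Rmult_comm. apply has_sum_scal, walk_cyc.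
  apply Rlt_le, Rinv_0_lt_compat, walk_center_pos.
- apply has_sum_gauss, Hic.
- intros N k. pose proof (walk_center_pos (steps c N)) as Hw.
  apply Rmult_le_reg_l with (walk (steps c N) 0); [exact Hw|].
  rewrite <- Rmult_assoc, Rinv_r, Rmult_1_l by lra.
  pose proof (steps_pos c N Hc) as Hp. apply Rle_trans with (1 := walk_gauss _ _ Hp).
  apply Rmult_le_compat_l; [lra|].
  apply lt_INR in Hp. simpl INR in Hp. pose proof (ell_ge1 N) as Hl.
  pose proof (steps_bounds c N Hc) as Hm. pose proof (pow2_ge_0 (IZR k)) as Hk.
  rewrite Z.add_0_l, mult_IZR, <- INR_IZR_INZ. fold (ell N).
  assert (Hle : / (2 * (c + 1)) * IZR k ^ 2 <= (ell N * IZR k) ^ 2 / (2 * INR (steps c N))).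
  { apply Rmult_le_reg_r with (2 * (c + 1) * INR (steps c N)); [apply Rmult_lt_0_compat; lra|].
    field_simplify; [|lra|lra].
    (* The rounding error 1 is absorbed by ell^2 >= 1, whence the c + 1 of the majorant. *)
    assert (INR (steps c N) <= (c + 1) * ell N ^ 2) by nra.
    pose proof (Rmult_le_compat_l _ _ _ Hk H). lra. }
  destruct (Rle_lt_or_eq_dec _ _ Hle) as [Hlt|Heq].
  + apply Rlt_le, exp_increasing. lra.
  + rewrite Heq. lra.
- intros k. apply is_lim_seq_ext with
    (fun N => walk (steps c N) (Z.of_nat ((2 * N + 1) * Z.abs_nat k)) / walk (steps c N) 0).
  { intros N. unfold Rdiv. rewrite Rmult_comm. f_equal.
    rewrite Z.add_0_l. destruct (Z_le_dec 0 k).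
    - f_equal. lia.
    - rewrite <- walk_opp. f_equal. lia. }
  replace (IZR k ^ 2) with (INR (Z.abs_nat k) ^ 2).
  + apply lim_walk_ratio, Hc.
  + rewrite INR_IZR_INZ, Zabs2Nat.id_abs, abs_IZR. apply pow2_abs.
Qed.

(** Write w_m for [walk m 0]. Then m w_m^2 increases because (2m+1)^2 >= 4m(m+1), and (2m+1) w_m^2
    is at most 1 because it starts at 1 and decreases, by (2m+1)(2m+3) <= (2m+2)^2. *)
Lemma lim_center : exists w : R,
  is_lim_seq (fun m => sqrt (INR m) * walk m 0) w.
Proof.
apply ex_finite_lim_seq_incr with 1.
- intros m. pose proof (walk_center m) as H. pose proof (walk_center_pos m) as H0.
  pose proof (walk_center_pos (S m)) as H1. pose proof (pos_INR m) as Hm.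
  rewrite S_INR in *.
  apply Rsqr_incr_0_var; [|apply Rmult_le_pos; [apply sqrt_pos|lra]].
  rewrite !Rsqr_mult, !Rsqr_sqrt by lra. unfold Rsqr.
  assert (E : walk (S m) 0 = (2 * INR m + 1) * walk m 0 / (2 * INR m + 2))
    by (rewrite <- H; field; lra).
  rewrite E.
  apply Rmult_le_reg_r with ((2 * INR m + 2) ^ 2); [apply pow_lt; lra|].
  field_simplify; [|lra].
  pose proof (pow2_ge_0 (walk m 0)). nra.
- intros m.
  assert (B : (2 * INR m + 1) * walk m 0 ^ 2 <= 1).
  { induction m as [|m IH].
    - simpl. lra.
    - pose proof (walk_center m) as H. pose proof (pos_INR m) as Hm. rewrite S_INR.
      assert (E : walk (S m) 0 = (2 * INR m + 1) * walk m 0 / (2 * INR m + 2))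
        by (rewrite <- H; field; lra).
      rewrite E. apply Rle_trans with (2 := IH).
      apply Rmult_le_reg_r with ((2 * INR m + 2) ^ 2); [apply pow_lt; lra|].
      apply Rle_trans with ((2 * INR m + 3) * (2 * INR m + 1) ^ 2 * walk m 0 ^ 2).
      + apply Req_le. field. lra.
      + pose proof (pow2_ge_0 (walk m 0)) as Hw.
        replace ((2 * INR m + 1) * walk m 0 ^ 2 * (2 * INR m + 2) ^ 2)
          with ((2 * INR m + 1) * (2 * INR m + 2) ^ 2 * walk m 0 ^ 2) by ring.
        apply Rmult_le_compat_r; [exact Hw|].
        replace ((2 * INR m + 1) * (2 * INR m + 2) ^ 2)
          with ((2 * INR m + 3) * (2 * INR m + 1) ^ 2 + (2 * INR m + 1)) by ring. lra. }
  pose proof (walk_center_pos m) as H0. pose proof (pos_INR m) as Hm.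
  apply Rsqr_incr_0_var; [|lra].
  rewrite !Rsqr_mult, !Rsqr_sqrt by lra. unfold Rsqr.
  pose proof (pow2_ge_0 (walk m 0)). nra.
Qed.

(** The constant [w] is [1 / sqrt PI]; evaluating at [c = 1 / PI] determines it without
    Wallis' formula. *)
Lemma theta_inversion_aux : exists w : R, forall c, 0 < c ->
  ramanujan_phi (exp (- (c * PI ^ 2))) = w / sqrt c * ramanujan_phi (exp (- / c)).
Proof.
destruct lim_center as [w Hw]. exists w. intros c Hc.
pose proof (sqrt_lt_R0 c Hc) as Hs.
(* The return probability times [ell] factors into [ell * walk], treated here, and [cyc / walk],
   treated in [lim_walk_side]; the square root of [steps] is asymptotic to sqrt c times [ell]. *)
assert (HC : is_lim_seq (fun N => ell N * walk (steps c N) 0) (w / sqrt c)).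
{ apply is_lim_seq_ext with
    (fun N => (sqrt (INR (steps c N)) * walk (steps c N) 0)
       / sqrt (INR (steps c N) / ell N ^ 2)).
  { intros N. pose proof (ell_ge1 N).
    pose proof (lt_0_INR _ (steps_pos c N Hc)) as Hp.
    rewrite sqrt_div_alt by (apply pow_lt; lra). rewrite sqrt_pow2 by lra.
    pose proof (sqrt_lt_R0 _ Hp). field. lra. }
  apply is_lim_seq_div'.
  - apply (is_lim_seq_subseq (fun m => sqrt (INR m) * walk m 0) w (steps c));
      [apply lim_steps, Hc|exact Hw].
  - apply is_lim_seq_continuous; [apply continuity_pt_sqrt; lra|].
    apply lim_steps_ratio, Hc.
  - lra. }
pose proof (is_lim_seq_mult' _ _ _ _ HC (lim_walk_side c Hc)) as HM.
pose proof (lim_cos_side c Hc) as HL.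
apply is_lim_seq_ext with (v := fun N => ell N * cyc N (steps c N) 0) in HM.
- apply is_lim_seq_unique in HM, HL. rewrite HM in HL. apply Rbar_finite_eq in HL. rewrite HL; reflexivity.
- intros N. pose proof (walk_center_pos (steps c N)). field. lra.
Qed.

Lemma phi_pos a : 0 < a -> 0 < ramanujan_phi (exp (- a)).
Proof.
intros Ha. apply Rlt_le_trans with (exp (- (a * IZR 0 ^ 2))); [apply exp_pos|].
apply (has_sum_term (fun k => exp (- (a * IZR k ^ 2))) _ 0%Z), has_sum_gauss, Ha.
Qed.

Lemma theta_inversion t : 0 < t ->
  ramanujan_phi (exp (- (PI * t))) = / sqrt t * ramanujan_phi (exp (- (PI / t))).
Proof.
intros Ht. pose proof PI_RGT_0 as Hpi.
destruct theta_inversion_aux as [w Hw].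
assert (E : w * sqrt PI = 1).
{ pose proof (Hw (/ PI) ltac:(apply Rinv_0_lt_compat; lra)) as H.
  rewrite Rinv_inv, sqrt_inv in H.
  replace (/ PI * PI ^ 2) with PI in H by (field; lra).
  unfold Rdiv in H. rewrite Rinv_inv in H.
  pose proof (phi_pos PI Hpi). nra. }
pose proof (Hw (t / PI) ltac:(apply Rdiv_lt_0_compat; lra)) as H.
replace (t / PI * PI ^ 2) with (PI * t) in H by (field; lra).
replace (/ (t / PI)) with (PI / t) in H by (field; lra).
rewrite H. f_equal. rewrite sqrt_div_alt by lra.
pose proof (sqrt_lt_R0 t Ht). pose proof (sqrt_lt_R0 PI Hpi).
replace (w / (sqrt t / sqrt PI)) with (w * sqrt PI / sqrt t) by (field; lra).
rewrite E. field. lra.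
Qed.

(** * Double series identities *)

Definition theta3 (t : R) : R := ramanujan_phi (exp (- (PI * t))).
(** Jacobi's functions at the nome exp(-PI t). In theta3(t/4) the even integers give theta3 t and
    the odd ones theta2 t; in theta3 t + theta4 t the odd terms cancel, leaving 2 theta3(4t). Taken
    as definitions, these relations let the exchange of [theta2] and [theta4] follow from the
    inversion of [theta3]. *)
Definition theta2 (t : R) : R := theta3 (t / 4) - theta3 t.
Definition theta4 (t : R) : R := 2 * theta3 (4 * t) - theta3 t.

Definition gauss (t x : R) : R := exp (- (PI * t * x ^ 2)).

Lemma PI_mult_pos t : 0 < t -> 0 < PI * t.
Proof. intros; apply Rmult_lt_0_compat; [apply PI_RGT_0|assumption]. Qed.

Lemma has_sum_theta3 t : 0 < t -> has_sum (fun k : Z => gauss t (IZR k)) (theta3 t).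
Proof. intros Ht. apply has_sum_gauss, PI_mult_pos, Ht. Qed.

Lemma has_sum_parity (f : Z -> R) a b :
  has_sum (fun k => f (2 * k)%Z) a -> has_sum (fun k => f (2 * k + 1)%Z) b ->
  has_sum f (a + b).
Proof.
intros Ha Hb.
set (h := fun p : Z + Z => match p with inl k => (2 * k)%Z | inr k => (2 * k + 1)%Z end).
set (g := fun z : Z => if Z.eq_dec (z mod 2) 0 then inl Z (z / 2)%Z else inr Z (z / 2)%Z).
assert (H : has_sum (fun p => f (h p)) (a + b)) by (apply has_sum_sum; assumption).
apply (has_sum_bij g h) in H.
- apply has_sum_ext with (2 := H). intros z. f_equal. unfold g, h.
  destruct Z.eq_dec; Z.div_mod_to_equations; lia.
- intros [n|n]; unfold g, h; destruct Z.eq_dec; try f_equal; Z.div_mod_to_equations; lia.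
- intros z; unfold g, h; destruct Z.eq_dec; Z.div_mod_to_equations; lia.
Qed.

Lemma has_sum_parity_fst (f : Z * Z -> R) a b :
  has_sum (fun p => f (2 * fst p, snd p)%Z) a ->
  has_sum (fun p => f (2 * fst p + 1, snd p)%Z) b -> has_sum f (a + b).
Proof.
intros Ha Hb.
set (h := fun p : Z * Z + Z * Z => match p with
  | inl p => (2 * fst p, snd p)%Z | inr p => (2 * fst p + 1, snd p)%Z end).
set (g := fun p : Z * Z => if Z.eq_dec (fst p mod 2) 0
  then inl (Z * Z)%type (fst p / 2, snd p)%Z else inr (Z * Z)%type (fst p / 2, snd p)%Z).
assert (H : has_sum (fun p => f (h p)) (a + b)) by (apply has_sum_sum; assumption).
apply (has_sum_bij g h) in H.
- apply has_sum_ext with (2 := H). intros [x y]. f_equal. unfold g, h; cbn [fst snd].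
  destruct Z.eq_dec; cbn [fst snd]; f_equal; Z.div_mod_to_equations; lia.
- intros [[x y]|[x y]]; unfold g, h; cbn [fst snd]; destruct Z.eq_dec;
    try do 2 f_equal; Z.div_mod_to_equations; lia.
- intros [x y]; unfold g, h; cbn [fst snd]; destruct Z.eq_dec; cbn [fst snd];
    f_equal; Z.div_mod_to_equations; lia.
Qed.

(** The pairs of equal parity form a sublattice of index 2, with half sum and half difference as
    coordinates; the second family runs over its other coset. *)
Lemma has_sum_parity_add (f : Z * Z -> R) a b :
  has_sum (fun p => f (fst p + snd p, fst p - snd p)%Z) a ->
  has_sum (fun p => f (fst p + snd p + 1, fst p - snd p)%Z) b -> has_sum f (a + b).
Proof.
intros Ha Hb.
set (h := fun p : Z * Z + Z * Z => match p with
  | inl p => (fst p + snd p, fst p - snd p)%Z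
  | inr p => (fst p + snd p + 1, fst p - snd p)%Z end).
set (g := fun p : Z * Z => let (x, y) := p in if Z.eq_dec ((x + y) mod 2) 0
  then inl (Z * Z)%type ((x + y) / 2, (x - y) / 2)%Z
  else inr (Z * Z)%type ((x + y) / 2, (x - y) / 2)%Z).
assert (H : has_sum (fun p => f (h p)) (a + b)) by (apply has_sum_sum; assumption).
apply (has_sum_bij g h) in H.
- apply has_sum_ext with (2 := H). intros [x y]. f_equal. unfold g, h.
  destruct Z.eq_dec; cbn [fst snd]; f_equal; Z.div_mod_to_equations; lia.
- intros [[x y]|[x y]]; unfold g, h; cbn [fst snd]; destruct Z.eq_dec;
    try do 2 f_equal; Z.div_mod_to_equations; lia.
- intros [x y]; unfold g, h; destruct Z.eq_dec; cbn [fst snd];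
    f_equal; Z.div_mod_to_equations; lia.
Qed.

Lemma theta3_split t : theta3 t = theta3 (4 * t) + theta2 (4 * t).
Proof. unfold theta2. replace (4 * t / 4) with t by field. ring. Qed.

Lemma theta4_split t : theta4 t = theta3 (4 * t) - theta2 (4 * t).
Proof. unfold theta4. rewrite (theta3_split t). ring. Qed.

Lemma has_sum_theta2 t : 0 < t ->
  has_sum (fun k : Z => gauss t (IZR k + / 2)) (theta2 t).
Proof.
intros Ht.
assert (H4 : has_sum (fun k : Z => gauss (t / 4) (IZR k)) (theta3 (t / 4)))
  by (apply has_sum_theta3; lra).
(* The odd terms have some sum, being a subfamily; uniqueness of the total then identifies it with
   the difference that defines [theta2]. *)
assert (Hi : forall x y, (2 * x + 1 = 2 * y + 1)%Z -> x = y) by (intros; lia).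
destruct (has_sum_inj (fun k => 2 * k + 1)%Z _ _ Hi H4) as [s Hs].
assert (He : has_sum (fun k : Z => gauss (t / 4) (IZR (2 * k))) (theta3 t)).
{ apply has_sum_ext with (2 := has_sum_theta3 t Ht). intros k. unfold gauss.
  rewrite mult_IZR. f_equal. field. }
pose proof (has_sum_unique _ _ _ H4 (has_sum_parity _ _ _ He Hs)) as E.
unfold theta2. rewrite E. replace (theta3 t + s - theta3 t) with s by ring.
apply has_sum_ext with (2 := Hs). intros k. unfold gauss.
rewrite plus_IZR, mult_IZR. f_equal. field.
Qed.

(** Reindexes the product of the sums [H1] and [H2] by the affine bijection [g] with inverse [h];
    what is left is the equality of two quadratic polynomials in the exponent. *)
Ltac product_by H1 H2 g h :=
  let H := fresh in
  pose proof (has_sum_bij g h _ _ ltac:(intros []; cbn [fst snd]; f_equal; lia)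
    ltac:(intros []; cbn [fst snd]; f_equal; lia) (has_sum_prod _ _ _ _ H1 H2)) as H;
  apply has_sum_ext with (2 := H); intros [? ?]; unfold gauss; cbn [fst snd];
  rewrite <- ?exp_plus; f_equal;
  rewrite ?plus_IZR, ?minus_IZR, ?mult_IZR, ?opp_IZR, ?plus_IZR, ?minus_IZR, ?mult_IZR,
    ?plus_IZR, ?minus_IZR, ?mult_IZR; field.

Lemma theta3_sqr t : 0 < t -> theta3 t ^ 2 = theta3 (2 * t) ^ 2 + theta2 (2 * t) ^ 2.
Proof.
intros Ht.
pose proof (has_sum_theta3 t Ht) as H.
pose proof (has_sum_theta3 (2 * t) ltac:(lra)) as H3.
pose proof (has_sum_theta2 (2 * t) ltac:(lra)) as H2.
replace (theta3 t ^ 2) with (theta3 t * theta3 t) by ring.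
rewrite <- !Rsqr_pow2. unfold Rsqr.
apply (has_sum_unique _ _ _ (has_sum_prod _ _ _ _ H H)).
apply has_sum_parity_add.
- product_by H3 H3 (fun p : Z * Z => p) (fun p : Z * Z => p).
- product_by H2 H2 (fun p : Z * Z => p) (fun p : Z * Z => p).
Qed.

(** For odd x, y the product [theta2 t * theta2 (3 * t)] runs over the numbers (x + y sqrt(-3))/2.
    Multiplying by the sixth root of unity (1 - sqrt(-3))/2 if 4 divides x - y, and by its conjugate
    otherwise, moves them into Z[sqrt(-3)]. Their norm is odd, so exactly one new coordinate is odd:
    this gives [O * E'] and [E * O'], each twice. *)
Lemma theta_cubic t : 0 < t ->
  theta3 t * theta3 (3 * t) = theta2 t * theta2 (3 * t) + theta4 t * theta4 (3 * t).
Proof.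
intros Ht. rewrite !theta4_split, (theta3_split t), (theta3_split (3 * t)).
pose proof (has_sum_theta3 (4 * t) ltac:(lra)) as HE.
pose proof (has_sum_theta2 (4 * t) ltac:(lra)) as HO.
pose proof (has_sum_theta3 (4 * (3 * t)) ltac:(lra)) as HE'.
pose proof (has_sum_theta2 (4 * (3 * t)) ltac:(lra)) as HO'.
pose proof (has_sum_theta2 t Ht) as H. pose proof (has_sum_theta2 (3 * t) ltac:(lra)) as H'.
set (E := theta3 (4 * t)) in *. set (O := theta2 (4 * t)) in *.
set (E' := theta3 (4 * (3 * t))) in *. set (O' := theta2 (4 * (3 * t))) in *.
assert (G : theta2 t * theta2 (3 * t) = (O * E' + E * O') + (E * O' + O * E')); [|rewrite G; ring].
apply (has_sum_unique _ _ _ (has_sum_prod _ _ _ _ H H')).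
apply has_sum_parity_add.
- apply (has_sum_bij (fun p : Z * Z => (snd p, fst p)) (fun p : Z * Z => (snd p, fst p))
    (fun p => gauss t (IZR (snd p + fst p) + / 2) * gauss (3 * t) (IZR (snd p - fst p) + / 2)));
    try (intros []; reflexivity).
  apply has_sum_parity_fst.
  + product_by HO HE' (fun p : Z * Z => (snd p - fst p, fst p)%Z)
      (fun p : Z * Z => (snd p, fst p + snd p)%Z).
  + product_by HE HO' (fun p : Z * Z => (snd p - fst p, fst p)%Z)
      (fun p : Z * Z => (snd p, fst p + snd p)%Z).
- apply has_sum_parity_fst.
  + product_by HE HO' (fun p : Z * Z => (snd p - fst p, fst p)%Z)
      (fun p : Z * Z => (snd p, fst p + snd p)%Z).
  + product_by HO HE' (fun p : Z * Z => (snd p - fst p - 1, fst p + 1)%Z)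
      (fun p : Z * Z => (snd p - 1, fst p + snd p)%Z).
Qed.

(** With [x = 2 m + 1], [y = 2 n + 1], the pairs [m = fst p + snd p], [n = fst p - snd p] are
    those with [x = y] modulo 4: the elements [(x + y sqrt(-7)) / 2] outside [Z[sqrt(-7)]] that
    are divisible by a fixed prime above 2. *)
Definition theta_half_coset (t : R) (p : Z * Z) : R :=
  gauss t (IZR (fst p + snd p) + / 2) * gauss (7 * t) (IZR (fst p - snd p) + / 2).

Lemma has_sum_half_coset t : 0 < t ->
  has_sum (theta_half_coset t) (theta2 t * theta2 (7 * t) / 2).
Proof.
intros Ht.
pose proof (has_sum_prod _ _ _ _ (has_sum_theta2 t Ht) (has_sum_theta2 (7 * t) ltac:(lra))) as H.
assert (Hi : forall p q : Z * Z,
  (fst p + snd p, fst p - snd p)%Z = (fst q + snd q, fst q - snd q)%Z -> p = q).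
{ intros [a b] [c d]; cbn [fst snd]; intros E; injection E; intros; f_equal; lia. }
destruct (has_sum_inj _ _ _ Hi H) as [s Hs]. cbn [fst snd] in Hs.
(* The sign change y -> -y exchanges the classes x = y and x = -y modulo 4, so each carries half of
   the product. *)
assert (Hs' : has_sum (fun p : Z * Z =>
  gauss t (IZR (fst p + snd p + 1) + / 2) * gauss (7 * t) (IZR (fst p - snd p) + / 2)) s).
{ apply (has_sum_bij (fun p : Z * Z => (snd p, fst p + 1)%Z)
    (fun p : Z * Z => (snd p - 1, fst p)%Z)) in Hs.
  2,3: intros [a b]; cbn [fst snd]; f_equal; lia.
  apply has_sum_ext with (2 := Hs). intros [a b]; cbn [fst snd]. unfold gauss.
  rewrite <- !exp_plus. f_equal.
  repeat rewrite ?plus_IZR, ?minus_IZR, ?opp_IZR. field. }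
pose proof (has_sum_unique _ _ _ H (has_sum_parity_add _ _ _ Hs Hs')) as E.
rewrite E. replace ((s + s) / 2) with s by field. exact Hs.
Qed.

Ltac coset_by H g h :=
  let G := fresh in
  pose proof (has_sum_bij g h _ _ ltac:(intros []; cbn [fst snd]; f_equal; lia)
    ltac:(intros []; cbn [fst snd]; f_equal; lia) H) as G;
  apply has_sum_ext with (2 := G); intros [? ?]; unfold theta_half_coset, gauss; cbn [fst snd];
  rewrite <- ?exp_plus; f_equal;
  repeat rewrite ?plus_IZR, ?minus_IZR, ?mult_IZR, ?opp_IZR; field.

(** The substitutions in the next two proofs are divisions by [(1 + sqrt(-7)) / 2], which halve
    the norm. *)
Lemma theta2_septic t : 0 < t ->
  theta2 t * theta2 (7 * t) / 2 =
  theta2 (8 * t) * theta3 (56 * t) + theta3 (8 * t) * theta2 (56 * t)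
  + theta2 (2 * t) * theta2 (14 * t) / 2.
Proof.
intros Ht.
pose proof (has_sum_half_coset t Ht) as H.
pose proof (has_sum_half_coset (2 * t) ltac:(lra)) as H'.
replace (7 * (2 * t)) with (14 * t) in H' by ring.
pose proof (has_sum_theta3 (8 * t) ltac:(lra)) as HE.
pose proof (has_sum_theta2 (8 * t) ltac:(lra)) as HO.
pose proof (has_sum_theta3 (56 * t) ltac:(lra)) as HE'.
pose proof (has_sum_theta2 (56 * t) ltac:(lra)) as HO'.
apply (has_sum_bij (fun p : Z * Z => (snd p, fst p)) (fun p : Z * Z => (snd p, fst p)))
  in H; try (intros []; reflexivity).
apply (has_sum_unique _ _ _ H).
apply has_sum_parity_fst.
- apply has_sum_parity_fst.
  + coset_by (has_sum_prod _ _ _ _ HO HE') (fun p : Z * Z => (snd p - 3 * fst p, fst p)%Z)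
      (fun p : Z * Z => (snd p, fst p + 3 * snd p)%Z).
  + coset_by (has_sum_prod _ _ _ _ HE HO') (fun p : Z * Z => (snd p - 3 * fst p - 1, fst p)%Z)
      (fun p : Z * Z => (snd p, fst p + 3 * snd p + 1)%Z).
- coset_by H' (fun p : Z * Z => (snd p - 2 * fst p - 1, snd p - fst p)%Z)
    (fun p : Z * Z => (snd p - fst p - 1, snd p + snd p - fst p - 1)%Z).
Qed.

Lemma theta_even_septic t : 0 < t ->
  theta3 (4 * t) * theta3 (28 * t) + theta2 (4 * t) * theta2 (28 * t) =
  theta3 (8 * t) * theta3 (56 * t) + theta2 (8 * t) * theta2 (56 * t)
  + theta2 (2 * t) * theta2 (14 * t) / 2.
Proof.
intros Ht.
pose proof (has_sum_half_coset (2 * t) ltac:(lra)) as H'.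
replace (7 * (2 * t)) with (14 * t) in H' by ring.
pose proof (has_sum_theta3 (4 * t) ltac:(lra)) as G3.
pose proof (has_sum_theta2 (4 * t) ltac:(lra)) as G2.
pose proof (has_sum_theta3 (28 * t) ltac:(lra)) as G3'.
pose proof (has_sum_theta2 (28 * t) ltac:(lra)) as G2'.
pose proof (has_sum_theta3 (8 * t) ltac:(lra)) as HE.
pose proof (has_sum_theta2 (8 * t) ltac:(lra)) as HO.
pose proof (has_sum_theta3 (56 * t) ltac:(lra)) as HE'.
pose proof (has_sum_theta2 (56 * t) ltac:(lra)) as HO'.
set (F := fun p : Z * Z => exp (- (PI * t * ((2 * IZR (snd p) + IZR (fst p)) ^ 2
  + 7 * IZR (fst p) ^ 2)))).
assert (HF : has_sum F (theta3 (4 * t) * theta3 (28 * t) + theta2 (4 * t) * theta2 (28 * t))).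
{ apply has_sum_parity_fst; unfold F.
  - product_by G3 G3' (fun p : Z * Z => (snd p + fst p, fst p)%Z)
      (fun p : Z * Z => (snd p, fst p - snd p)%Z).
  - product_by G2 G2' (fun p : Z * Z => (snd p + fst p, fst p)%Z)
      (fun p : Z * Z => (snd p, fst p - snd p)%Z). }
apply (has_sum_bij (fun p : Z * Z => (snd p, fst p)) (fun p : Z * Z => (snd p, fst p)))
  in HF; try (intros []; reflexivity).
apply (has_sum_unique _ _ _ HF).
apply has_sum_parity_fst; unfold F.
- apply has_sum_parity_fst.
  + product_by HE HE' (fun p : Z * Z => (snd p + fst p, fst p)%Z)
      (fun p : Z * Z => (snd p, fst p - snd p)%Z).
  + product_by HO HO' (fun p : Z * Z => (snd p + fst p, fst p)%Z)
      (fun p : Z * Z => (snd p, fst p - snd p)%Z).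
- coset_by H' (fun p : Z * Z => (fst p + snd p, snd p)%Z)
    (fun p : Z * Z => (fst p - snd p, snd p)%Z).
Qed.

(** Split [theta3 t] and [theta3 (7 * t)] by parity. [theta2_septic] at t/2 and at t gives the mixed
    products, [theta_even_septic] the others. The terms theta2(2t) theta2(14t)/2 cancel, and the
    products at 8t and 56t factor as theta4(2t) theta4(14t). *)
Lemma theta_septic t : 0 < t ->
  theta3 t * theta3 (7 * t) =
  theta2 (t / 2) * theta2 (7 * t / 2) / 2 + theta4 (2 * t) * theta4 (14 * t).
Proof.
intros Ht.
pose proof (theta2_septic (t / 2) ltac:(lra)) as H0.
pose proof (theta2_septic t Ht) as H1.
pose proof (theta_even_septic t Ht) as H2.
rewrite !theta4_split, (theta3_split t), (theta3_split (7 * t)).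
replace (7 * (t / 2)) with (7 * t / 2) in H0 by field.
replace (8 * (t / 2)) with (4 * t) in H0 by field.
replace (56 * (t / 2)) with (28 * t) in H0 by field.
replace (2 * (t / 2)) with t in H0 by field.
replace (14 * (t / 2)) with (7 * t) in H0 by field.
replace (4 * (7 * t)) with (28 * t) by ring.
replace (4 * (2 * t)) with (8 * t) by ring.
replace (4 * (14 * t)) with (56 * t) by ring.
lra.
Qed.

(** * Positivity, inversion and duplication of the theta functions *)

Lemma theta3_pos t : 0 < t -> 0 < theta3 t.
Proof. intros Ht. apply phi_pos, PI_mult_pos, Ht. Qed.

Lemma theta2_pos t : 0 < t -> 0 < theta2 t.
Proof.
intros Ht. apply Rlt_le_trans with (gauss t (IZR 0 + / 2)); [apply exp_pos|].
apply (has_sum_term (fun k => gauss t (IZR k + / 2)) _ 0%Z), has_sum_theta2, Ht.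
Qed.

Lemma theta3_inv t : 0 < t -> theta3 (/ t) = sqrt t * theta3 t.
Proof.
intros Ht. unfold theta3 at 2. rewrite theta_inversion by exact Ht.
pose proof (sqrt_lt_R0 t Ht).
rewrite <- Rmult_assoc, Rinv_r, Rmult_1_l by lra. reflexivity.
Qed.

Lemma theta2_inv t : 0 < t -> theta2 (/ t) = sqrt t * theta4 t.
Proof.
intros Ht. unfold theta2, theta4.
replace (/ t / 4) with (/ (4 * t)) by (field; lra).
rewrite !theta3_inv by lra. rewrite sqrt_mult by lra.
replace 4 with (2 * 2) at 1 by ring. rewrite sqrt_square by lra. ring.
Qed.

Lemma theta4_inv t : 0 < t -> theta4 (/ t) = sqrt t * theta2 t.
Proof.
intros Ht. unfold theta2, theta4.
replace (4 * / t) with (/ (t / 4)) by (field; lra).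
rewrite !theta3_inv by lra. rewrite sqrt_div_alt by lra.
replace 4 with (2 * 2) at 1 by ring. rewrite sqrt_square by lra. field.
Qed.

Lemma theta4_pos t : 0 < t -> 0 < theta4 t.
Proof.
intros Ht. pose proof (Rinv_0_lt_compat t Ht) as Hi.
rewrite <- (Rinv_inv t), theta4_inv by exact Hi.
apply Rmult_lt_0_compat; [apply sqrt_lt_R0, Hi|apply theta2_pos, Hi].
Qed.

(** Expand [theta3_sqr] at t/2, where theta3(t/2) = theta3(2t) + theta2(2t), and subtract
    [theta3_sqr] at t. *)
Lemma theta2_half_sqr t : 0 < t -> theta2 t ^ 2 = 2 * theta2 (2 * t) * theta3 (2 * t).
Proof.
intros Ht.
pose proof (theta3_sqr (t / 2) ltac:(lra)) as H1.
pose proof (theta3_sqr t Ht) as H2.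
rewrite (theta3_split (t / 2)) in H1.
replace (2 * (t / 2)) with t in H1 by field.
replace (4 * (t / 2)) with (2 * t) in H1 by field. nra.
Qed.

Lemma theta4_sqr t : 0 < t -> theta4 t ^ 2 = theta3 (2 * t) ^ 2 - theta2 (2 * t) ^ 2.
Proof.
intros Ht.
pose proof (theta3_sqr (2 * t) ltac:(lra)) as H1.
pose proof (theta2_half_sqr (2 * t) ltac:(lra)) as H2.
replace (2 * (2 * t)) with (4 * t) in * by ring.
rewrite theta4_split. nra.
Qed.

Lemma theta4_double_sqr t : 0 < t -> theta4 (2 * t) ^ 2 = theta3 t * theta4 t.
Proof.
intros Ht. rewrite theta4_sqr by lra. rewrite theta4_split, (theta3_split t).
replace (2 * (2 * t)) with (4 * t) by ring. ring.
Qed.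

(** Together with [theta4_double_sqr]: doubling [t] replaces theta3^2 and theta4^2 by their
    arithmetic and geometric means. *)
Lemma theta3_double_sqr t : 0 < t ->
  theta3 (2 * t) ^ 2 = (theta3 t ^ 2 + theta4 t ^ 2) / 2.
Proof. intros Ht. rewrite theta4_sqr, (theta3_sqr t) by exact Ht. field. Qed.

Lemma jacobi_quartic t : 0 < t -> theta3 t ^ 4 = theta2 t ^ 4 + theta4 t ^ 4.
Proof.
intros Ht.
replace (theta2 t ^ 4) with ((theta2 t ^ 2) ^ 2) by ring.
replace (theta4 t ^ 4) with ((theta4 t ^ 2) ^ 2) by ring.
replace (theta3 t ^ 4) with ((theta3 t ^ 2) ^ 2) by ring.
rewrite theta2_half_sqr, theta4_sqr, (theta3_sqr t) by exact Ht. ring.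
Qed.

(** * The differential equation of the modulus *)

(** Coefficients of the one-sided series of q^(n^2). As a power series, phi is differentiable on the
    whole disc, including q = 0, where the limit of [log_rate] is taken. *)
Definition square_indicator (n : nat) : R :=
  if Nat.eq_dec (Nat.sqrt n * Nat.sqrt n) n then 1 else 0.

Definition phi_ps (q : R) : R := 2 * PSeries square_indicator q - 1.
Definition phi_ps' (q : R) : R := 2 * PSeries (PS_derive square_indicator) q.

Lemma has_sum_sparse {T U} (i : U -> T) (f : T -> R) s :
  (forall x y, i x = i y -> x = y) -> (forall x, 0 <= f x) ->
  (forall x, f x <> 0 -> exists y, i y = x) ->
  has_sum (fun y => f (i y)) s -> has_sum f s.
Proof.
intros Hi H0 Hsup [_ [H1 H2]]; split; [exact H0|]; split.
- intros l Hl.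
  assert (G : exists l', NoDup l' /\ incl (map i l') l /\ lsum f l = lsum f (map i l')).
  { induction l as [|x l IH].
    - exists nil; repeat split; [constructor|intros y []].
    - inversion Hl; subst.
      destruct (IH ltac:(assumption)) as [l' [N [I E]]].
      destruct (Req_dec (f x) 0) as [Hx|Hx].
      + exists l'; split; [exact N|split; [apply incl_tl, I|]]. simpl. lra.
      + destruct (Hsup x Hx) as [y Hy]. exists (y :: l'); split; [|split].
        * constructor; [|exact N]. intros Hy'. apply (in_map i) in Hy'.
          rewrite Hy in Hy'. apply I in Hy'. contradiction.
        * simpl. rewrite Hy. apply incl_cons; [left; reflexivity|apply incl_tl, I].
        * simpl. rewrite Hy, E. reflexivity. }
  destruct G as [l' [N [_ ->]]]. rewrite lsum_map. apply H1, N.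
- intros eps He. destruct (H2 eps He) as [l [Hl E]]. exists (map i l).
  split; [apply Injective_map_NoDup; assumption|]. rewrite lsum_map. exact E.
Qed.

Lemma square_indicator_bound n : 0 <= square_indicator n <= 1.
Proof. unfold square_indicator. destruct Nat.eq_dec; lra. Qed.

Lemma phi_ps_eq q : 0 < q < 1 -> ramanujan_phi q = phi_ps q.
Proof.
intros Hq.
destruct (ramanujan_phi_converges q) as [C1 C2]; [apply Rabs_def1; lra|].
set (g := fun n : nat => powerRZ q (Z.of_nat n * Z.of_nat n)) in *.
set (S0 := Series g).
assert (E1 : ramanujan_phi q = 2 * S0 - 1).
{ unfold ramanujan_phi, bilateral_series. fold g. fold S0.
  assert (E : S0 = g 0%nat + Series (fun n => g (S n))) by apply Series_incr_1, C1.
  assert (G0 : g 0%nat = 1) by reflexivity.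
  rewrite (Series_ext _ (fun n => g (S n))); [lra|].
  intros n. unfold g. reflexivity. }
rewrite E1. unfold phi_ps. do 2 f_equal.
assert (HS : has_sum g S0).
{ apply has_sum_series; [intros; apply powerRZ_le; lra|apply Series_correct, C1]. }
assert (Hpos : forall n, 0 <= square_indicator n * q ^ n).
{ intros n. apply Rmult_le_pos; [apply square_indicator_bound|apply pow_le; lra]. }
apply (has_sum_unique (fun n => square_indicator n * q ^ n)).
- apply (has_sum_sparse (fun n => n * n)%nat).
  + intros x y. nia.
  + exact Hpos.
  + intros n. unfold square_indicator. destruct Nat.eq_dec as [E|E]; [|lra].
    intros _. exists (Nat.sqrt n). exact E.
  + apply has_sum_ext with (2 := HS). intros n. unfold g, square_indicator.
    rewrite Nat.sqrt_square. destruct Nat.eq_dec; [|lia].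
    rewrite <- Nat2Z.inj_mul, <- pow_powerRZ. ring.
- apply has_sum_series; [exact Hpos|]. unfold PSeries. apply Series_correct.
  apply (ex_series_le (K := R_AbsRing) (V := R_CompleteNormedModule) _ (fun n => q ^ n)).
  + intros n. change (Rabs (square_indicator n * q ^ n) <= q ^ n).
    rewrite Rabs_pos_eq by apply Hpos.
    pose proof (square_indicator_bound n). pose proof (pow_le q n ltac:(lra)). nra.
  + apply ex_series_geom. rewrite Rabs_pos_eq; lra.
Qed.

Lemma square_indicator_radius q : Rabs q < 1 ->
  Rbar_lt (Rabs q) (CV_radius square_indicator).
Proof.
intros Hq. apply Rbar_lt_le_trans with 1; [exact Hq|].
apply (proj1 (CV_radius_bounded square_indicator)). exists 1. intros n.
rewrite pow1, Rmult_1_r. pose proof (square_indicator_bound n).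
rewrite Rabs_pos_eq; lra.
Qed.

Lemma phi_ps_derive q : Rabs q < 1 -> is_derive phi_ps q (phi_ps' q).
Proof.
intros Hq. unfold phi_ps, phi_ps'.
pose proof (is_derive_PSeries _ q (square_indicator_radius q Hq)) as H.
replace (2 * PSeries (PS_derive square_indicator) q)
  with (minus (2 * PSeries (PS_derive square_indicator) q) 0)
  by (unfold minus, plus, opp; simpl; ring).
apply (is_derive_minus (fun x => 2 * PSeries square_indicator x) (fun _ => 1)).
- apply is_derive_scal, H.
- apply @is_derive_const.
Qed.

Lemma phi_ps'_continuous q : Rabs q < 1 -> continuity_pt phi_ps' q.
Proof.
intros Hq. apply (continuity_pt_mult (fun _ => 2)).
- apply continuity_pt_const. intros x y; reflexivity.
- apply PSeries_continuity. rewrite CV_radius_derive. apply square_indicator_radius, Hq.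
Qed.

Lemma phi_ps_0 : phi_ps 0 = 1.
Proof. unfold phi_ps. rewrite PSeries_0. unfold square_indicator. simpl. ring. Qed.

Lemma phi_ps'_0 : phi_ps' 0 = 2.
Proof. unfold phi_ps'. rewrite PSeries_0. unfold PS_derive, square_indicator. simpl. ring. Qed.

Definition nome (t : R) : R := exp (- (PI * t)).

Lemma nome_bounds t : 0 < t -> 0 < nome t < 1.
Proof.
intros Ht. split; [apply exp_pos|]. rewrite <- exp_0. apply exp_increasing.
pose proof (PI_mult_pos t Ht). lra.
Qed.

Lemma nome_4 t : nome (4 * t) = nome t ^ 4.
Proof. unfold nome. simpl. rewrite Rmult_1_r, <- !exp_plus. f_equal. ring. Qed.

Lemma theta3_ps t : 0 < t -> theta3 t = phi_ps (nome t).
Proof. intros Ht. apply phi_ps_eq, nome_bounds, Ht. Qed.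

Definition theta3' (t : R) : R := - PI * nome t * phi_ps' (nome t).

Lemma theta3_derive t : 0 < t -> is_derive theta3 t (theta3' t).
Proof.
intros Ht.
apply (is_derive_ext_loc (fun t => phi_ps (nome t))).
{ exists (mkposreal t Ht). intros s Hs. symmetry. apply theta3_ps.
  change (Rabs (s - t) < t) in Hs. apply Rabs_def2 in Hs. lra. }
unfold theta3'. apply (is_derive_comp phi_ps nome).
- apply phi_ps_derive. pose proof (nome_bounds t Ht). apply Rabs_def1; lra.
- unfold nome. auto_derive; [trivial|]. ring.
Qed.

(** The fourth root of 1 - alpha. With it both the duplication and the degree 7 equation can be
    written without eighth roots. *)
Definition ratio (t : R) : R := theta4 t / theta3 t.

Definition ratio' (t : R) : R :=
  2 * (4 * theta3' (4 * t) * theta3 t - theta3 (4 * t) * theta3' t) / theta3 t ^ 2.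

Lemma ratio_pos t : 0 < t -> 0 < ratio t.
Proof. intros Ht. apply Rdiv_lt_0_compat; [apply theta4_pos|apply theta3_pos]; exact Ht. Qed.

Lemma ratio_compl t : 0 < t -> 1 - ratio t ^ 4 = (theta2 t / theta3 t) ^ 4.
Proof.
intros Ht. pose proof (jacobi_quartic t Ht) as J. pose proof (theta3_pos t Ht) as H.
unfold ratio.
replace ((theta4 t / theta3 t) ^ 4) with (theta4 t ^ 4 / theta3 t ^ 4) by (field; lra).
replace ((theta2 t / theta3 t) ^ 4) with (theta2 t ^ 4 / theta3 t ^ 4) by (field; lra).
replace (theta4 t ^ 4) with (theta3 t ^ 4 - theta2 t ^ 4) by lra. field. lra.
Qed.

Lemma ratio_lt1 t : 0 < t -> ratio t < 1.
Proof.
intros Ht. pose proof (ratio_compl t Ht) as E. pose proof (ratio_pos t Ht) as Hp.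
assert (H : 0 < (theta2 t / theta3 t) ^ 4).
{ apply pow_lt, Rdiv_lt_0_compat; [apply theta2_pos|apply theta3_pos]; exact Ht. }
apply Rnot_le_lt; intros Hle.
assert (1 ^ 4 <= ratio t ^ 4) by (apply pow_incr; lra). rewrite pow1 in *. lra.
Qed.

Lemma ratio_derive t : 0 < t -> is_derive ratio t (ratio' t).
Proof.
intros Ht. pose proof (theta3_pos t Ht) as Hp.
pose proof (theta3_derive t Ht) as H1.
pose proof (theta3_derive (4 * t) ltac:(lra)) as H4.
unfold ratio, ratio', theta4. auto_derive.
- repeat split; try (eexists; eassumption); lra.
- rewrite (is_derive_unique (fun x : R => theta3 x) t _ H1).
  rewrite (is_derive_unique (fun x : R => theta3 x) (4 * t) _ H4). field. lra.
Qed.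

Lemma ratio_double t : 0 < t -> ratio (2 * t) ^ 2 = 2 * ratio t / (1 + ratio t ^ 2).
Proof.
intros Ht. pose proof (theta3_pos t Ht). pose proof (theta4_pos t Ht).
unfold ratio.
replace ((theta4 (2 * t) / theta3 (2 * t)) ^ 2)
  with (theta4 (2 * t) ^ 2 / theta3 (2 * t) ^ 2)
  by (field; apply Rgt_not_eq, theta3_pos; lra).
rewrite theta4_double_sqr, theta3_double_sqr by exact Ht. field.
repeat split; try lra; nra.
Qed.

Lemma ratio_derive_double t : 0 < t ->
  4 * ratio (2 * t) * ratio' (2 * t)
  = 2 * ratio' t * (1 - ratio t ^ 2) / (1 + ratio t ^ 2) ^ 2.
Proof.
intros Ht.
pose proof (ratio_derive t Ht) as H1.
pose proof (ratio_derive (2 * t) ltac:(lra)) as H2.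
assert (Hp : 0 < 1 + ratio t ^ 2) by (pose proof (pow2_ge_0 (ratio t)); lra).
assert (D1 : is_derive (fun s => ratio (2 * s) ^ 2) t (4 * ratio (2 * t) * ratio' (2 * t))).
{ auto_derive; [eexists; exact H2|].
  rewrite (is_derive_unique (fun x : R => ratio x) (2 * t) _ H2). ring. }
assert (D2 : is_derive (fun s => 2 * ratio s / (1 + ratio s ^ 2)) t
   (2 * ratio' t * (1 - ratio t ^ 2) / (1 + ratio t ^ 2) ^ 2)).
{ auto_derive.
  - repeat split; try (eexists; exact H1). apply Rgt_not_eq. simpl in Hp |- *. lra.
  - rewrite (is_derive_unique (fun x : R => ratio x) t _ H1). field. lra. }
rewrite <- (is_derive_unique _ _ _ D1), <- (is_derive_unique _ _ _ D2).
apply Derive_ext_loc. exists (mkposreal t Ht). intros s Hs.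
change (Rabs (s - t) < t) in Hs. apply Rabs_def2 in Hs. apply ratio_double. lra.
Qed.

(** Invariant under [t -> 2 t], hence equal to its limit at infinity, that is at [q = 0]. *)
Definition log_rate (t : R) : R := ratio' t / (ratio t * (1 - ratio t ^ 4) * theta3 t ^ 4).

(** For y at t and Y at 2t one has 1 - Y^4 = ((1 - y^2)/(1 + y^2))^2 and theta3(2t)^2 = theta3(t)^2
    (1 + y^2)/2; with the derivative of the duplication formula everything cancels. *)
Lemma log_rate_double t : 0 < t -> log_rate (2 * t) = log_rate t.
Proof.
intros Ht. pose proof (ratio_pos t Ht) as Hy. pose proof (ratio_lt1 t Ht) as Hy1.
pose proof (theta3_pos t Ht) as H3.
pose proof (ratio_pos (2 * t) ltac:(lra)) as HY.
pose proof (ratio_double t Ht) as E1. pose proof (ratio_derive_double t Ht) as E2.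
unfold log_rate.
replace (theta3 (2 * t) ^ 4) with ((theta3 (2 * t) ^ 2) ^ 2) by ring.
rewrite theta3_double_sqr by exact Ht.
assert (E4 : theta4 t = ratio t * theta3 t) by (unfold ratio; field; lra).
rewrite E4.
set (Y := ratio (2 * t)) in *. set (y := ratio t) in *.
assert (Hp : 0 < 1 + y ^ 2) by (pose proof (pow2_ge_0 y); lra).
assert (Hm : 0 < 1 - y ^ 2) by (clear - Hy Hy1; nra).
assert (E3 : ratio' (2 * t) = ratio' t * (1 - y ^ 2) * Y / (4 * y * (1 + y ^ 2))).
{ apply Rmult_eq_reg_l with (4 * Y); [|lra]. rewrite E2.
  replace (4 * Y * (ratio' t * (1 - y ^ 2) * Y / (4 * y * (1 + y ^ 2))))
    with (ratio' t * (1 - y ^ 2) * Y ^ 2 / (y * (1 + y ^ 2))) by (field; lra).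
  rewrite E1. field. lra. }
rewrite E3. replace (Y ^ 4) with ((Y ^ 2) ^ 2) by ring. rewrite E1.
replace (1 - y ^ 4) with ((1 - y ^ 2) * (1 + y ^ 2)) by ring.
replace (1 - (2 * y / (1 + y ^ 2)) ^ 2) with ((1 - y ^ 2) ^ 2 / (1 + y ^ 2) ^ 2) by (field; lra).
field. repeat split; try lra.
apply Rgt_not_eq. pose proof (pow_lt _ 2 H3). pose proof (pow2_ge_0 (y * theta3 t)). lra.
Qed.

Lemma lim_nome t : 0 < t -> is_lim_seq (fun n => nome (2 ^ n * t)) 0.
Proof.
intros Ht. apply is_lim_seq_le_le with (fun _ => 0) (fun n => / (PI * t) * (/ 2) ^ n).
- intros n. pose proof (PI_mult_pos t Ht) as Hp. split; [apply Rlt_le, exp_pos|].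
  unfold nome. rewrite exp_Ropp, pow_inv, <- Rinv_mult.
  assert (0 < 2 ^ n) by (apply pow_lt; lra).
  apply Rinv_le_contravar; [apply Rmult_lt_0_compat; lra|].
  pose proof (exp_ineq1_le (PI * (2 ^ n * t))). lra.
- apply is_lim_seq_const.
- replace (Finite 0) with (Finite (/ (PI * t) * 0)) by (f_equal; ring).
  apply is_lim_seq_mult'; [apply is_lim_seq_const|].
  apply is_lim_seq_geom. rewrite Rabs_pos_eq; lra.
Qed.

Lemma lim_phi_quotient (q : nat -> R) : (forall n, 0 < q n) -> is_lim_seq q 0 ->
  is_lim_seq (fun n => (phi_ps (q n) - 1) / q n) 2.
Proof.
intros Hpos Hq.
assert (D : derivable_pt_lim phi_ps 0 2).
{ apply is_derive_Reals. rewrite <- phi_ps'_0. apply phi_ps_derive. rewrite Rabs_R0; lra. }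
apply is_lim_seq_spec. intros eps. destruct (D eps (cond_pos eps)) as [d Hd].
apply is_lim_seq_spec in Hq. destruct (Hq d) as [N HN]. exists N; intros n Hn.
specialize (HN n Hn). rewrite Rminus_0_r in HN.
specialize (Hd (q n) ltac:(specialize (Hpos n); lra) HN).
rewrite Rplus_0_l, phi_ps_0 in Hd. exact Hd.
Qed.

Lemma lim_log_rate t : 0 < t -> is_lim_seq (fun n => log_rate (2 ^ n * t)) (PI / 4).
Proof.
intros Ht.
set (q := fun n => nome (2 ^ n * t)). set (q4 := fun n => q n ^ 4).
assert (Htn : forall n, 0 < 2 ^ n * t)
  by (intros; apply Rmult_lt_0_compat; [apply pow_lt; lra|exact Ht]).
assert (Hq : is_lim_seq q 0) by apply lim_nome, Ht.
assert (Hqp : forall n, 0 < q n) by (intros; apply exp_pos).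
assert (Hq3 : is_lim_seq (fun n => q n * (q n * q n)) 0).
{ replace (Finite 0) with (Finite (0 * (0 * 0))) by (f_equal; ring).
  repeat apply is_lim_seq_mult'; exact Hq. }
assert (Hq4 : is_lim_seq q4 0).
{ apply is_lim_seq_ext with (fun n => q n * (q n * (q n * q n))).
  - intros; unfold q4; ring.
  - replace (Finite 0) with (Finite (0 * (0 * (0 * 0)))) by (f_equal; ring).
    repeat apply is_lim_seq_mult'; exact Hq. }
assert (Hq4p : forall n, 0 < q4 n) by (intros; apply pow_lt, Hqp).
assert (C : forall u, is_lim_seq u 0 -> is_lim_seq (fun n => phi_ps (u n)) 1).
{ intros u Hu. rewrite <- phi_ps_0. apply is_lim_seq_continuous; [|exact Hu].
  apply derivable_continuous_pt. eexists. apply is_derive_Reals, phi_ps_derive.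
  rewrite Rabs_R0; lra. }
assert (C' : forall u, is_lim_seq u 0 -> is_lim_seq (fun n => phi_ps' (u n)) 2).
{ intros u Hu. rewrite <- phi_ps'_0. apply is_lim_seq_continuous; [|exact Hu].
  apply phi_ps'_continuous. rewrite Rabs_R0; lra. }
pose proof (lim_phi_quotient q Hqp Hq) as L1.
pose proof (lim_phi_quotient q4 Hq4p Hq4) as L4.
set (y := fun n => 2 * phi_ps (q4 n) / phi_ps (q n) - 1).
assert (Hy : is_lim_seq y 1).
{ replace (Finite 1) with (Finite (2 * 1 / 1 - 1)) by (f_equal; field).
  apply is_lim_seq_minus'; [|apply is_lim_seq_const].
  apply is_lim_seq_div'; [|apply C, Hq|lra].
  apply is_lim_seq_mult'; [apply is_lim_seq_const|apply C, Hq4]. }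
(* At q = 0 [log_rate] is of the form 0/0: both [ratio'] and 1 - [ratio] are of order q. One factor
   q is removed from each, the second through (phi(q) - phi(q^4))/q = (phi(q) - 1)/q - q^3 (phi(q^4)
   - 1)/q^4. *)
apply is_lim_seq_ext with (fun n =>
  PI * (phi_ps (q4 n) * phi_ps' (q n)
        - 4 * (q n * (q n * q n)) * phi_ps' (q4 n) * phi_ps (q n))
  / (phi_ps (q n) * ((phi_ps (q n) - 1) / q n
        - q n * (q n * q n) * ((phi_ps (q4 n) - 1) / q4 n)))
  / (y n * ((1 + y n) * (1 + y n * y n)) * (phi_ps (q n) * phi_ps (q n)
      * (phi_ps (q n) * phi_ps (q n))))).
- intros n. set (s := 2 ^ n * t).
  assert (Hs : 0 < s) by apply Htn.
  assert (E1 : phi_ps (q n) = theta3 s) by (symmetry; apply theta3_ps, Hs).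
  assert (E4 : phi_ps (q4 n) = theta3 (4 * s)).
  { rewrite theta3_ps by lra. rewrite nome_4. reflexivity. }
  pose proof (theta3_pos s Hs) as P1. pose proof (ratio_pos s Hs) as P2.
  pose proof (ratio_lt1 s Hs) as P3.
  assert (Ey : y n = ratio s).
  { unfold y, ratio, theta4. rewrite E1, E4. field. lra. }
  assert (Hr : theta3 s - theta3 (4 * s) = (1 - ratio s) * theta3 s / 2).
  { unfold ratio, theta4. field. lra. }
  assert (Hd : (phi_ps (q n) - 1) / q n - q n * (q n * q n) * ((phi_ps (q4 n) - 1) / q4 n)
    = (1 - ratio s) * theta3 s / 2 / q n).
  { rewrite <- Hr, E1, E4. unfold q4. specialize (Hqp n). field. lra. }
  rewrite Hd, Ey, E1, E4. unfold log_rate, ratio', theta3'. rewrite nome_4.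
  change (nome s) with (q n). change (q n ^ 4) with (q4 n).
  replace (1 - ratio s ^ 4) with ((1 - ratio s) * (1 + ratio s) * (1 + ratio s * ratio s)) by ring.
  unfold q4 at 2. specialize (Hqp n). field. repeat split; try lra; nra.
- replace (Finite (PI / 4)) with (Finite (PI * (1 * 2 - 4 * 0 * 2 * 1)
    / (1 * (2 - 0 * 2)) / (1 * ((1 + 1) * (1 + 1 * 1)) * (1 * 1 * (1 * 1)))))
    by (f_equal; field).
  apply is_lim_seq_div'; [apply is_lim_seq_div'| |lra].
  + repeat (apply is_lim_seq_mult' || apply is_lim_seq_minus'); auto using is_lim_seq_const.
  + repeat (apply is_lim_seq_mult' || apply is_lim_seq_minus'); auto using is_lim_seq_const.
  + lra.
  + repeat (apply is_lim_seq_mult' || apply is_lim_seq_plus'); auto using is_lim_seq_const.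
Qed.

Lemma log_rate_eq t : 0 < t -> log_rate t = PI / 4.
Proof.
intros Ht. pose proof (lim_log_rate t Ht) as H.
apply is_lim_seq_ext with (v := fun _ => log_rate t) in H.
- apply is_lim_seq_unique in H. rewrite Lim_seq_const in H. apply Rbar_finite_eq, H.
- intros n; induction n as [|n IH].
  + rewrite pow_O, Rmult_1_l. reflexivity.
  + rewrite <- IH, <- (log_rate_double (2 ^ n * t)).
    * rewrite <- Rmult_assoc. reflexivity.
    * apply Rmult_lt_0_compat; [apply pow_lt; lra|exact Ht].
Qed.

(** With alpha = 1 - [ratio]^4 and q d/dq = -(1/PI) d/dt this is q dalpha/dq = alpha (1 - alpha)
    theta3^4. *)
Lemma ratio_ode t : 0 < t ->
  is_derive ratio t (PI / 4 * (ratio t * (1 - ratio t ^ 4) * theta3 t ^ 4)).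
Proof.
intros Ht. pose proof (theta3_pos t Ht). pose proof (ratio_pos t Ht).
assert (0 < 1 - ratio t ^ 4).
{ rewrite ratio_compl by exact Ht. apply pow_lt, Rdiv_lt_0_compat; [apply theta2_pos, Ht|lra]. }
rewrite <- (log_rate_eq t Ht).
replace (log_rate t * _) with (ratio' t); [apply ratio_derive, Ht|].
unfold log_rate. field. repeat split; try lra; try (apply Rgt_not_eq; lra).
Qed.

(** * The octic equation *)

(** For [s = sqrt 3], [x^6 = 28], the octic satisfied by [u] is a quadratic without real roots
    times a sextic that has [u_root s x] as a root. *)
Definition u_root (s x : R) : R :=
  1 / 2 - 1 / 3 * x - 1 / 12 * x ^ 3 + 1 / 24 * x ^ 5 - 1 / 3 * s + 1 / 12 * s * x ^ 2.

(** The claimed value as an element of Q(s, x): x^3 = sqrt 28 = 2 sqrt 7 gives sqrt 21 = s x^3/2,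
    and 3/s = s. *)
Definition r_root (s x : R) : R :=
  (s * x ^ 2 + 8 * x + 2 * x ^ 3 + 2 * s + x ^ 5 / 2) / 42.

(** Three squarings, each reduced by s^2 = 3 and x^6 = 28 to the twelve monomials s^i x^j with i < 2
    and j < 6, which keeps the expressions small. *)
Lemma u_root_pow8 (s x : R) (Hs : s ^ 2 = 3) (Hx : x ^ 6 = 28) :
  u_root s x ^ 8 =
    1401 / 16 + 631 / 8 * x + 167 / 16 * x ^ 2 - 19 * x ^ 3 - 413 / 32 * x ^ 4 - 37
    / 16 * x ^ 5 - 175 / 3 * s - 631 / 16 * s * x - 167 / 24 * s * x ^ 2 + 19 / 2 *
    s * x ^ 3 + 413 / 48 * s * x ^ 4 + 37 / 32 * s * x ^ 5.
Proof.
set (u := u_root s x).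
assert (H2 : u ^ 2 =
    - (1 / 3 * x) - 1 / 4 * x ^ 2 - 1 / 12 * x ^ 3 + 1 / 8 * x ^ 4 + 1 / 24 * x ^ 5
    - 1 / 3 * s + 5 / 12 * s * x + 1 / 12 * s * x ^ 2 - 1 / 24 * s * x ^ 5)
  by (unfold u, u_root; field [Hs Hx]).
assert (H4 : u ^ 4 =
    - (59 / 12) - 31 / 12 * x + 17 / 24 * x ^ 2 + 2 / 3 * x ^ 3 + 1 / 3 * x ^ 4 + 1
    / 24 * x ^ 5 + 7 / 3 * s + s * x + 1 / 12 * s * x ^ 2 - 1 / 2 * s * x ^ 3 - 7 /
    24 * s * x ^ 4 + 1 / 16 * s * x ^ 5)
  by (replace (u ^ 4) with (u ^ 2 * u ^ 2) by ring; rewrite H2; field [Hs Hx]).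
replace (u ^ 8) with (u ^ 4 * u ^ 4) by ring. rewrite H4. field [Hs Hx].
Qed.

(** The sign change (s, x) -> (-s, -x) preserves both relations and sends [u_root s x] to 1 -
    [u_root s x], so this is [u_root_pow8] with those signs changed. *)
Lemma u_root_compl_pow8 (s x : R) (Hs : s ^ 2 = 3) (Hx : x ^ 6 = 28) :
  (1 - u_root s x) ^ 8 =
    1401 / 16 - 631 / 8 * x + 167 / 16 * x ^ 2 + 19 * x ^ 3 - 413 / 32 * x ^ 4 + 37
    / 16 * x ^ 5 + 175 / 3 * s - 631 / 16 * s * x + 167 / 24 * s * x ^ 2 + 19 / 2 *
    s * x ^ 3 - 413 / 48 * s * x ^ 4 + 37 / 32 * s * x ^ 5.
Proof.
set (v := 1 - u_root s x).
assert (H2 : v ^ 2 =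
    1 / 3 * x - 1 / 4 * x ^ 2 + 1 / 12 * x ^ 3 + 1 / 8 * x ^ 4 - 1 / 24 * x ^ 5 + 1
    / 3 * s + 5 / 12 * s * x - 1 / 12 * s * x ^ 2 - 1 / 24 * s * x ^ 5)
  by (unfold v, u_root; field [Hs Hx]).
assert (H4 : v ^ 4 =
    - (59 / 12) + 31 / 12 * x + 17 / 24 * x ^ 2 - 2 / 3 * x ^ 3 + 1 / 3 * x ^ 4 - 1
    / 24 * x ^ 5 - 7 / 3 * s + s * x - 1 / 12 * s * x ^ 2 - 1 / 2 * s * x ^ 3 + 7 /
    24 * s * x ^ 4 + 1 / 16 * s * x ^ 5)
  by (replace (v ^ 4) with (v ^ 2 * v ^ 2) by ring; rewrite H2; field [Hs Hx]).
replace (v ^ 8) with (v ^ 4 * v ^ 4) by ring. rewrite H4. field [Hs Hx].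
Qed.

(** For alpha = (2 - s)/4, u^8 = alpha beta and (1 - u)^8 = (1 - alpha)(1 - beta), the sum (1 -
    alpha) u^8 + alpha (1 - u)^8 is free of beta and equals alpha (1 - alpha) = 1/16. *)
Lemma u_root_octic (s x : R) (Hs : s ^ 2 = 3) (Hx : x ^ 6 = 28) :
  (2 + s) / 4 * u_root s x ^ 8 + (2 - s) / 4 * (1 - u_root s x) ^ 8 = / 16.
Proof.
rewrite u_root_pow8, u_root_compl_pow8 by assumption. field [Hs Hx].
Qed.

Lemma r_root_sqr (s x : R) (Hs : s ^ 2 = 3) (Hx : x ^ 6 = 28) :
  r_root s x ^ 2 =
    29 / 147 + 11 / 147 * x ^ 2 + 1 / 42 * x ^ 4 + 5 / 147 * s * x + 2 / 147 * s * x
    ^ 3 + 1 / 294 * s * x ^ 5.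
Proof. unfold r_root. field [Hs Hx]. Qed.

(** The form that [septic_multiplier] takes at alpha = (2 - s)/4 once beta is eliminated by alpha
    beta = u^8. *)
Lemma r_root_multiplier (s x : R) (Hs : s ^ 2 = 3) (Hx : x ^ 6 = 28) :
  7 * r_root s x ^ 2 * (u_root s x ^ 8 - u_root s x * ((2 - s) / 4))
  = (2 - s) / 4 * (u_root s x - (2 - s) / 4).
Proof.
rewrite u_root_pow8, r_root_sqr by assumption. unfold u_root. field [Hs Hx].
Qed.

(** * The modular equation of degree 7 and its multiplier *)

Lemma ratio_compl_pos t : 0 < t -> 0 < 1 - ratio t ^ 4.
Proof.
intros Ht. rewrite ratio_compl by exact Ht.
apply pow_lt, Rdiv_lt_0_compat; [apply theta2_pos|apply theta3_pos]; exact Ht.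
Qed.

Lemma ratio_incr a b : 0 < a -> a < b -> ratio a < ratio b.
Proof.
intros Ha Hab.
apply (incr_function ratio 0 p_infty
  (fun t => PI / 4 * (ratio t * (1 - ratio t ^ 4) * theta3 t ^ 4))); simpl; auto.
- intros x Hx _. apply ratio_ode, Hx.
- intros x Hx _. pose proof PI_RGT_0.
  apply Rmult_lt_0_compat; [lra|]. apply Rmult_lt_0_compat.
  + apply Rmult_lt_0_compat; [apply ratio_pos|apply ratio_compl_pos]; exact Hx.
  + apply (pow_lt _ 4), theta3_pos, Hx.
Qed.

(** [theta_septic] divided by theta3(t) theta3(7t). By duplication the theta4 term becomes sqrt(y Y)
    = ((1-alpha)(1-beta))^(1/8), and the square of the theta2 term becomes (alpha beta)^(1/4). The
    sign, lost in the eighth power, is recorded separately. *)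
Lemma ratio_septic t : 0 < t ->
  (1 - sqrt (ratio t * ratio (7 * t))) ^ 8
    = (1 - ratio t ^ 4) * (1 - ratio (7 * t) ^ 4)
  /\ 0 < 1 - sqrt (ratio t * ratio (7 * t)).
Proof.
intros Ht. assert (Ht7 : 0 < 7 * t) by lra.
pose proof (theta3_pos t Ht) as A3. pose proof (theta3_pos _ Ht7) as B3.
pose proof (theta2_pos (t / 2) ltac:(lra)) as A2. pose proof (theta2_pos (7 * t / 2) ltac:(lra)) as B2.
pose proof (theta4_pos (2 * t) ltac:(lra)) as A4. pose proof (theta4_pos (14 * t) ltac:(lra)) as B4.
pose proof (theta_septic t Ht) as E.
pose proof (theta2_half_sqr (t / 2) ltac:(lra)) as EA.
pose proof (theta2_half_sqr (7 * t / 2) ltac:(lra)) as EB.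
replace (2 * (t / 2)) with t in EA by field.
replace (2 * (7 * t / 2)) with (7 * t) in EB by field.
pose proof (theta4_double_sqr t Ht) as FA.
pose proof (theta4_double_sqr (7 * t) Ht7) as FB.
replace (2 * (7 * t)) with (14 * t) in FB by ring.
set (u := theta2 (t / 2) * theta2 (7 * t / 2) / 2 / (theta3 t * theta3 (7 * t))).
set (v := theta4 (2 * t) * theta4 (14 * t) / (theta3 t * theta3 (7 * t))).
assert (Huv : 1 - v = u).
{ unfold u, v. apply Rmult_eq_reg_r with (theta3 t * theta3 (7 * t)); [|nra].
  field_simplify; [|lra|lra]. rewrite E. field. }
assert (Hu : 0 < u).
{ unfold u. apply Rdiv_lt_0_compat; [|apply Rmult_lt_0_compat; assumption].
  pose proof (Rmult_lt_0_compat _ _ A2 B2). lra. }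
assert (Hv : sqrt (ratio t * ratio (7 * t)) = v).
{ apply Rsqr_inj.
  - apply sqrt_pos.
  - apply Rlt_le, Rdiv_lt_0_compat; apply Rmult_lt_0_compat; assumption.
  - rewrite Rsqr_sqrt.
    + unfold v, ratio. rewrite Rsqr_pow2.
      replace ((theta4 (2 * t) * theta4 (14 * t) / (theta3 t * theta3 (7 * t))) ^ 2)
        with (theta4 (2 * t) ^ 2 * theta4 (14 * t) ^ 2 / (theta3 t * theta3 (7 * t)) ^ 2)
        by (field; lra).
      rewrite FA, FB. field. lra.
    + apply Rlt_le, Rmult_lt_0_compat; apply ratio_pos; assumption. }
rewrite Hv, Huv. split; [|exact Hu].
rewrite !ratio_compl by assumption.
replace (u ^ 8) with ((u ^ 2) ^ 4) by ring.
assert (Eu : u ^ 2 = theta2 t / theta3 t * (theta2 (7 * t) / theta3 (7 * t))).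
{ unfold u.
  replace ((theta2 (t / 2) * theta2 (7 * t / 2) / 2 / (theta3 t * theta3 (7 * t))) ^ 2)
    with (theta2 (t / 2) ^ 2 * theta2 (7 * t / 2) ^ 2 / 4 / (theta3 t * theta3 (7 * t)) ^ 2)
    by (field; lra).
  rewrite EA, EB. field. lra. }
rewrite Eu. field. lra.
Qed.

(** Differentiate both sides of [ratio_septic], insert [ratio_ode] at t and 7t, and replace (1 -
    y^4)(1 - Y^4) by (1 - v)^8; the common factor PI (1 - v)^7 is nonzero and cancels. *)
Lemma septic_multiplier t : 0 < t ->
  let y := ratio t in let Y := ratio (7 * t) in
  let v := sqrt (y * Y) in
  v * ((1 - y ^ 4) * theta3 t ^ 4 + 7 * (1 - Y ^ 4) * theta3 (7 * t) ^ 4)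
  = (1 - v) * (y ^ 4 * theta3 t ^ 4 + 7 * Y ^ 4 * theta3 (7 * t) ^ 4).
Proof.
intros Ht y Y v. assert (Ht7 : 0 < 7 * t) by lra.
pose proof (ratio_ode t Ht) as D1. pose proof (ratio_ode (7 * t) Ht7) as D7.
pose proof (ratio_pos t Ht) as Hy. pose proof (ratio_pos _ Ht7) as HY.
pose proof (ratio_compl_pos t Ht) as Gy. pose proof (ratio_compl_pos _ Ht7) as GY.
destruct (ratio_septic t Ht) as [E Hu].
pose proof PI_RGT_0 as Hpi.
fold y in D1, Hy, Gy, E, Hu. fold Y in D7, HY, GY, E, Hu. fold v in E, Hu.
set (d := PI / 4 * (y * (1 - y ^ 4) * theta3 t ^ 4)) in *.
set (d7 := PI / 4 * (Y * (1 - Y ^ 4) * theta3 (7 * t) ^ 4)) in *.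
assert (Hyy : 0 < y * Y) by (apply Rmult_lt_0_compat; assumption).
assert (Hv : 0 < v) by apply sqrt_lt_R0, Hyy.
assert (Hv2 : v * v = y * Y) by (apply sqrt_sqrt; lra).
set (dv := (d * Y + 7 * d7 * y) / (2 * v)).
assert (DL : is_derive (fun s => (1 - sqrt (ratio s * ratio (7 * s))) ^ 8) t
  (- (8 * (1 - v) ^ 7 * dv))).
{ auto_derive.
  - repeat split; try (eexists; eassumption). exact Hyy.
  - rewrite (is_derive_unique (fun x : R => ratio x) t _ D1).
    rewrite (is_derive_unique (fun x : R => ratio x) (7 * t) _ D7).
    fold y Y v. unfold dv. field. lra. }
assert (DR : is_derive (fun s => (1 - ratio s ^ 4) * (1 - ratio (7 * s) ^ 4)) t
  (- (4 * y ^ 3 * d * (1 - Y ^ 4) + 28 * Y ^ 3 * d7 * (1 - y ^ 4)))).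
{ auto_derive.
  - repeat split; eexists; eassumption.
  - rewrite (is_derive_unique (fun x : R => ratio x) t _ D1).
    rewrite (is_derive_unique (fun x : R => ratio x) (7 * t) _ D7).
    fold y Y. ring. }
assert (EQ : - (8 * (1 - v) ^ 7 * dv)
  = - (4 * y ^ 3 * d * (1 - Y ^ 4) + 28 * Y ^ 3 * d7 * (1 - y ^ 4))).
{ rewrite <- (is_derive_unique _ _ _ DL), <- (is_derive_unique _ _ _ DR).
  apply Derive_ext_loc. exists (mkposreal t Ht). intros s Hs.
  change (Rabs (s - t) < t) in Hs. apply Rabs_def2 in Hs. apply ratio_septic. lra. }
assert (Edv : dv = PI / 8 * v *
  ((1 - y ^ 4) * theta3 t ^ 4 + 7 * (1 - Y ^ 4) * theta3 (7 * t) ^ 4)).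
{ unfold dv, d, d7. apply Rmult_eq_reg_r with (2 * v); [|lra].
  replace (PI / 8 * v * ((1 - y ^ 4) * theta3 t ^ 4 + 7 * (1 - Y ^ 4) * theta3 (7 * t) ^ 4)
    * (2 * v)) with (PI / 4 * (v * v) *
    ((1 - y ^ 4) * theta3 t ^ 4 + 7 * (1 - Y ^ 4) * theta3 (7 * t) ^ 4)) by field.
  rewrite Hv2. field. lra. }
assert (ER : 4 * y ^ 3 * d * (1 - Y ^ 4) + 28 * Y ^ 3 * d7 * (1 - y ^ 4)
  = PI * (1 - v) ^ 8 * (y ^ 4 * theta3 t ^ 4 + 7 * Y ^ 4 * theta3 (7 * t) ^ 4)).
{ rewrite E. unfold d, d7. field. }
rewrite ER, Edv in EQ.
apply Rmult_eq_reg_l with (PI * (1 - v) ^ 7).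
- apply Ropp_eq_reg. transitivity (- (8 * (1 - v) ^ 7 * (PI / 8 * v *
  ((1 - y ^ 4) * theta3 t ^ 4 + 7 * (1 - Y ^ 4) * theta3 (7 * t) ^ 4)))); [field|].
  rewrite EQ. ring.
- apply Rgt_not_eq, Rmult_lt_0_compat; [lra|]. apply pow_lt, Hu.
Qed.

(** * Evaluation at t = sqrt 3 *)

Lemma ratio_sqrt3 : ratio (sqrt 3) ^ 4 = (2 + sqrt 3) / 4.
Proof.
set (s := sqrt 3).
assert (Hs : 0 < s) by (apply sqrt_lt_R0; lra).
assert (Hs2 : s * s = 3) by (apply sqrt_sqrt; lra).
pose proof (Rinv_0_lt_compat s Hs) as Hi.
pose proof (theta_cubic (/ s) Hi) as C.
replace (3 * / s) with s in C by (rewrite <- Hs2; field; lra).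
rewrite theta3_inv, theta2_inv, theta4_inv in C by exact Hs.
pose proof (sqrt_lt_R0 s Hs) as Hss.
pose proof (theta3_pos s Hs) as P3. pose proof (theta4_pos s Hs) as P4.
(* At t = 1/s the argument 3t is s itself, so inversion turns both products on the right of the
   cubic identity into theta2 s * theta4 s. *)
assert (E : theta3 s ^ 2 = 2 * theta2 s * theta4 s).
{ apply Rmult_eq_reg_l with (sqrt s); [|lra]. lra. }
pose proof (ratio_compl s Hs) as J.
assert (E' : 16 * (ratio s ^ 4 * (1 - ratio s ^ 4)) = 1).
{ rewrite J. unfold ratio.
  replace (16 * ((theta4 s / theta3 s) ^ 4 * (theta2 s / theta3 s) ^ 4))
    with ((2 * theta2 s * theta4 s) ^ 4 / (theta3 s ^ 2) ^ 4) by (field; lra).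
  rewrite <- E. field. lra. }
(* Chooses between the roots (2 + s)/4 and (2 - s)/4: t = 1 is fixed by inversion, so alpha = 1/2
   there, and [ratio] increases. *)
assert (G : / 2 < ratio s ^ 4).
{ assert (H1 : ratio 1 ^ 4 = / 2).
  { pose proof (ratio_compl 1 Rlt_0_1) as J1.
    pose proof (theta2_inv 1 Rlt_0_1) as I. rewrite Rinv_1, sqrt_1, Rmult_1_l in I.
    rewrite I in J1. unfold ratio in *. lra. }
  rewrite <- H1. pose proof (ratio_pos 1 Rlt_0_1) as Hp.
  assert (Hlt : ratio 1 < ratio s).
  { apply ratio_incr; [lra|]. rewrite <- sqrt_1. apply sqrt_lt_1; lra. }
  replace (ratio 1 ^ 4) with ((ratio 1 ^ 2) * (ratio 1 ^ 2)) by ring.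
  replace (ratio s ^ 4) with ((ratio s ^ 2) * (ratio s ^ 2)) by ring.
  assert (ratio 1 ^ 2 < ratio s ^ 2) by nra.
  pose proof (pow_lt _ 2 Hp). nra. }
assert (F : (ratio s ^ 4 - (2 + s) / 4) * (ratio s ^ 4 - (2 - s) / 4) = 0) by nra.
apply Rmult_integral in F. destruct F as [F|F]; lra.
Qed.

Lemma sqrt3_bounds : 1.732 < sqrt 3 < 1.7321.
Proof.
assert (H : sqrt 3 * sqrt 3 = 3) by (apply sqrt_sqrt; lra).
pose proof (sqrt_pos 3). split; nra.
Qed.

Lemma pow8_diff p q : p ^ 8 - q ^ 8 = (p - q) * ((p + q) * ((p ^ 2 + q ^ 2) * (p ^ 4 + q ^ 4))).
Proof. ring. Qed.

(** The octic has a second real root near 0.713, so a bound on [u] is needed to single out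
    [u_root]. *)
Lemma octic_decr a u w : 6 / 100 <= a <= 1 -> 0 < u -> u < w -> w < 3 / 10 ->
  (1 - a) * w ^ 8 + a * (1 - w) ^ 8 < (1 - a) * u ^ 8 + a * (1 - u) ^ 8.
Proof.
intros Ha Hu Huw Hw.
(* Per unit of w - u the first term grows by at most 0.0018, whereas the second falls by at least
   0.6 a >= 0.036. *)
assert (H1 : w ^ 8 - u ^ 8 <= (w - u) * (18 / 10000)).
{ rewrite pow8_diff. apply Rmult_le_compat_l; [lra|].
  assert (w ^ 2 + u ^ 2 <= 18 / 100) by nra.
  assert (w ^ 2 <= 9 / 100) by nra. assert (u ^ 2 <= 9 / 100) by nra.
  assert (0 <= w ^ 2) by nra. assert (0 <= u ^ 2) by nra.
  assert (w ^ 4 + u ^ 4 <= 162 / 10000).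
  { replace (w ^ 4) with (w ^ 2 * w ^ 2) by ring.
    replace (u ^ 4) with (u ^ 2 * u ^ 2) by ring. nra. }
  assert (0 <= w ^ 4 + u ^ 4).
  { replace (w ^ 4) with (w ^ 2 * w ^ 2) by ring.
    replace (u ^ 4) with (u ^ 2 * u ^ 2) by ring. nra. }
  assert ((w ^ 2 + u ^ 2) * (w ^ 4 + u ^ 4) <= 18 / 100 * (162 / 10000))
    by (apply Rmult_le_compat; lra).
  assert (0 <= (w ^ 2 + u ^ 2) * (w ^ 4 + u ^ 4)) by (apply Rmult_le_pos; lra).
  apply Rle_trans with (6 / 10 * (18 / 100 * (162 / 10000))); [|lra].
  apply Rmult_le_compat; lra. }
assert (H2 : (w - u) * (6 / 10) <= (1 - u) ^ 8 - (1 - w) ^ 8).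
{ rewrite pow8_diff. replace (1 - u - (1 - w)) with (w - u) by ring.
  apply Rmult_le_compat_l; [lra|].
  set (p := 1 - u). set (q := 1 - w).
  assert (7 / 10 < p) by (unfold p; lra). assert (7 / 10 < q) by (unfold q; lra).
  assert (49 / 100 <= p ^ 2) by nra. assert (49 / 100 <= q ^ 2) by nra.
  assert (2401 / 10000 <= p ^ 4) by (replace (p ^ 4) with (p ^ 2 * p ^ 2) by ring; nra).
  assert (2401 / 10000 <= q ^ 4) by (replace (q ^ 4) with (q ^ 2 * q ^ 2) by ring; nra).
  assert (98 / 100 * (4802 / 10000) <= (p ^ 2 + q ^ 2) * (p ^ 4 + q ^ 4))
    by (apply Rmult_le_compat; lra).
  apply Rle_trans with (14 / 10 * (98 / 100 * (4802 / 10000))); [lra|].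
  apply Rmult_le_compat; lra. }
nra.
Qed.

(** Interval arithmetic starting from x^2 = 28^(1/3), about 3.0366. The bound 3/10 is the range in
    which [octic_decr] makes the octic injective. *)
Lemma u_root_bounds s x : 1.732 < s < 1.7321 -> 0 < x -> x ^ 6 = 28 ->
  0 < u_root s x < 3 / 10.
Proof.
intros Hs Hx H6.
assert (H2 : 3.036 < x ^ 2 < 3.037).
{ replace (x ^ 6) with (x ^ 2 * (x ^ 2 * x ^ 2)) in H6 by ring.
  pose proof (pow_lt x 2 Hx). split; apply Rnot_le_lt; intros Hle.
  - assert (x ^ 2 * x ^ 2 <= 3.036 * 3.036) by nra. nra.
  - assert (3.037 * 3.037 <= x ^ 2 * x ^ 2) by nra. nra. }
assert (H1 : 1.7424 < x < 1.7427) by (split; nra).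
assert (H3 : x ^ 3 = x * x ^ 2) by ring.
assert (H5 : x ^ 5 = x * (x ^ 2 * x ^ 2)) by ring.
assert (B4 : 3.036 * 3.036 < x ^ 2 * x ^ 2 < 3.037 * 3.037) by (split; nra).
assert (B3 : 1.7424 * 3.036 < x ^ 3 < 1.7427 * 3.037) by (rewrite H3; split; nra).
assert (B5 : 1.7424 * (3.036 * 3.036) < x ^ 5 < 1.7427 * (3.037 * 3.037))
  by (rewrite H5; split; nra).
assert (Bs : 1.732 * 3.036 < s * x ^ 2 < 1.7321 * 3.037) by (split; nra).
unfold u_root. lra.
Qed.

Theorem theorem6p3 :
  (ramanujan_phi (exp (- (7 * PI * sqrt 3)))) ^ 2
    / (ramanujan_phi (exp (- (PI * sqrt 3)))) ^ 2
  = 1 / (42 * sqrt 3)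
    * ((sqrt 21 + 3) * Rpower 28 (1 / 3)
       + 8 * sqrt 3 * Rpower 28 (1 / 6)
       + 4 * sqrt 21 + 6).
Proof.
set (x := Rpower 28 (1 / 6)).
assert (Hx : 0 < x) by apply exp_pos.
assert (Hx6 : x ^ 6 = 28).
{ unfold x. rewrite <- Rpower_pow by apply exp_pos. rewrite Rpower_mult.
  replace (1 / 6 * INR 6) with 1 by (simpl; field). apply Rpower_1. lra. }
assert (Hx2 : Rpower 28 (1 / 3) = x ^ 2).
{ unfold x. rewrite <- Rpower_pow by apply exp_pos. rewrite Rpower_mult.
  f_equal. simpl; field. }
pose proof sqrt3_bounds as Bs.
assert (Hs2 : sqrt 3 ^ 2 = 3) by (apply pow2_sqrt; lra).
pose proof ratio_sqrt3 as Ey4.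
set (s := sqrt 3) in *.
assert (H21 : sqrt 21 = s * x ^ 3 / 2).
{ apply sqrt_lem_1; [lra| |].
  - pose proof (pow_lt x 3 Hx). nra.
  - replace (s * x ^ 3 / 2 * (s * x ^ 3 / 2)) with (s ^ 2 * x ^ 6 / 4) by field.
    rewrite Hs2, Hx6. field. }
assert (Hs : 0 < s) by lra. assert (Hs7 : 0 < 7 * s) by lra.
replace (ramanujan_phi (exp (- (7 * PI * s)))) with (theta3 (7 * s))
  by (unfold theta3; do 3 f_equal; ring).
change (ramanujan_phi (exp (- (PI * s)))) with (theta3 s).
transitivity (r_root s x).
2: { rewrite Hx2, H21. unfold r_root.
  apply Rmult_eq_reg_l with (42 * s); [|lra]. field_simplify; [|lra].
  replace (s ^ 2) with 3 by (symmetry; exact Hs2). field. }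
pose proof (theta3_pos s Hs) as A3. pose proof (theta3_pos _ Hs7) as B3.
destruct (ratio_septic s Hs) as [E8 Hu]. pose proof (septic_multiplier s Hs) as M.
cbv zeta in M.
set (u := 1 - sqrt (ratio s * ratio (7 * s))) in *.
replace (sqrt (ratio s * ratio (7 * s))) with (1 - u) in M by (unfold u; ring).
set (a := (2 - s) / 4).
assert (Ba : 6 / 100 <= a <= 7 / 100) by (unfold a; lra).
assert (Ea : ratio s ^ 4 = 1 - a) by (rewrite Ey4; unfold a; field).
assert (Ev8 : (1 - u) ^ 8 = (1 - a) * ratio (7 * s) ^ 4).
{ replace (1 - u) with (sqrt (ratio s * ratio (7 * s))) by (unfold u; ring).
  replace (sqrt (ratio s * ratio (7 * s)) ^ 8)
    with ((sqrt (ratio s * ratio (7 * s)) ^ 2) ^ 4) by ring.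
  rewrite pow2_sqrt
    by (apply Rlt_le, Rmult_lt_0_compat; apply ratio_pos; assumption).
  rewrite <- Ea. ring. }
rewrite Ea in E8, M.
set (b := 1 - ratio (7 * s) ^ 4) in *.
replace (ratio (7 * s) ^ 4) with (1 - b) in Ev8, M by (unfold b; ring).
replace (1 - (1 - a)) with a in E8, M by ring.
assert (Pb : 0 < b) by apply ratio_compl_pos, Hs7.
(* Here b is beta. By monotonicity it is below the value of 1 - [ratio]^4 at 2s, which one
   duplication step gives as ((1 - y^2)/(1 + y^2))^2. *)
assert (Bb : b < 5 / 10000).
{ assert (Hlt : ratio (2 * s) < ratio (7 * s)) by (apply ratio_incr; lra).
  pose proof (ratio_double s Hs) as D. pose proof (ratio_pos s Hs) as Py.
  pose proof (ratio_lt1 s Hs) as Py1. pose proof (ratio_pos (2 * s) ltac:(lra)) as PY.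
  set (y := ratio s) in *. set (Y := ratio (2 * s)) in *.
  assert (By : 96 / 100 < y ^ 2).
  { replace (y ^ 4) with (y ^ 2 * y ^ 2) in Ea by ring.
    pose proof (pow_lt y 2 Py). apply Rnot_le_lt; intros Hle.
    assert (y ^ 2 * y ^ 2 <= 96 / 100 * (96 / 100)) by nra. lra. }
  assert (By1 : y ^ 2 < 1) by nra.
  assert (EY : 1 - Y ^ 4 = ((1 - y ^ 2) / (1 + y ^ 2)) ^ 2).
  { replace (Y ^ 4) with ((Y ^ 2) ^ 2) by ring. rewrite D. field. lra. }
  assert (Bq : 0 <= (1 - y ^ 2) / (1 + y ^ 2) <= 21 / 1000).
  { split; [apply Rdiv_le_0_compat; lra|]. apply Rle_div_l; lra. }
  assert (Y ^ 4 <= ratio (7 * s) ^ 4) by (apply pow_incr; lra).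
  unfold b. nra. }
(* u^8 = alpha beta is below 3.5 / 10^5, whereas (3/10)^8 exceeds 6.5 / 10^5. *)
assert (Bu : u < 3 / 10).
{ apply Rnot_le_lt; intros Hle.
  assert ((3 / 10) ^ 8 <= u ^ 8) by (apply pow_incr; lra).
  assert (u ^ 8 < 7 / 100 * (5 / 10000)) by (rewrite E8; nra). lra. }
pose proof (u_root_bounds s x Bs Hx Hx6) as Bw.
assert (Eu : u = u_root s x).
{ pose proof (u_root_octic s x Hs2 Hx6) as O.
  assert (O' : (1 - a) * u ^ 8 + a * (1 - u) ^ 8 = / 16).
  { rewrite E8, Ev8. transitivity (a * (1 - a)); [ring|]. unfold a.
    replace ((2 - s) / 4 * (1 - (2 - s) / 4)) with ((4 - s ^ 2) / 16) by field.
    rewrite Hs2. field. }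
  replace ((2 + s) / 4) with (1 - a) in O by (unfold a; field). fold a in O.
  destruct (Rtotal_order u (u_root s x)) as [H|[H|H]]; [exfalso|exact H|exfalso].
  - pose proof (octic_decr a u (u_root s x) ltac:(lra) Hu H ltac:(lra)). lra.
  - pose proof (octic_decr a (u_root s x) u ltac:(lra) ltac:(lra) H Bu). lra. }
set (r := theta3 (7 * s) ^ 2 / theta3 s ^ 2).
assert (Pr : 0 < r) by (apply Rdiv_lt_0_compat; apply pow_lt; assumption).
assert (Er : theta3 (7 * s) ^ 4 = r ^ 2 * theta3 s ^ 4) by (unfold r; field; lra).
rewrite Er in M.
assert (M1 : (1 - u) * (a + 7 * b * r ^ 2) = u * ((1 - a) + 7 * (1 - b) * r ^ 2)).
{ apply Rmult_eq_reg_r with (theta3 s ^ 4); [|apply Rgt_not_eq, pow_lt, A3].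
  replace ((1 - u) * (a + 7 * b * r ^ 2) * theta3 s ^ 4)
    with ((1 - u) * (a * theta3 s ^ 4 + 7 * b * (r ^ 2 * theta3 s ^ 4))) by ring.
  rewrite M. replace (1 - (1 - u)) with u by ring. ring. }
(* Expanding [M1] leaves 7 r^2 (b - u) = u - a; multiplying by a turns a b into u^8. *)
assert (M2 : 7 * r ^ 2 * (u ^ 8 - u * a) = a * (u - a)).
{ rewrite E8. replace (a * b - u * a) with (a * (b - u)) by ring. nra. }
pose proof (r_root_multiplier s x Hs2 Hx6) as M0. fold a in M0. rewrite <- Eu in M0.
(* The coefficient of r^2 must be nonzero for [M2] and [r_root_multiplier] to determine the same
   r^2; u < 3/10 makes u^7 smaller than a. *)
assert (Hne : u ^ 8 - u * a < 0).
{ assert (Hu2 : u ^ 2 < 9 / 100) by nra.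
  pose proof (pow_lt u 2 Hu) as P2. pose proof (pow_lt u 3 Hu) as P3.
  assert (u ^ 3 < 27 / 1000) by (replace (u ^ 3) with (u * u ^ 2) by ring; nra).
  assert (u ^ 7 < a).
  { replace (u ^ 7) with (u * (u ^ 3 * u ^ 3)) by ring.
    assert (u ^ 3 * u ^ 3 < 1 / 100) by nra.
    assert (0 < u ^ 3 * u ^ 3) by (apply Rmult_lt_0_compat; lra). nra. }
  replace (u ^ 8 - u * a) with (u * (u ^ 7 - a)) by ring. nra. }
assert (Er2 : r ^ 2 = r_root s x ^ 2).
{ apply Rmult_eq_reg_r with (7 * (u ^ 8 - u * a)); [|lra]. lra. }
assert (Pr0 : 0 < r_root s x).
{ unfold r_root. pose proof (pow_lt x 2 Hx). pose proof (pow_lt x 3 Hx).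
  pose proof (pow_lt x 5 Hx). pose proof (Rmult_lt_0_compat s (x ^ 2) Hs ltac:(assumption)).
  lra. }
apply Rsqr_inj; [lra|lra|]. rewrite !Rsqr_pow2. exact Er2.
Qed.
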